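(* Let $T>0$, $A\in L^1(0,T;\mathbb{R}^{n\times n})$, $B\in L^2(0,T;\mathbb{R}^{n\times m})$, and assume that the system $[A,B]$ is completely controllable. Let $Q\in L^1(0,T;\mathbb{S}^n)$ with $Q\ge0$ a.e., and let $R\in L^\infty(0,T;\mathbb{S}^m)$ with $R(s)\ge\delta I$ for a.e. $s$, for some $\delta>0$. Let $t\in[0,T)$. Then the Riccati equation $$\dot P(s)+P(s)A(s)+A(s)^\top P(s)+Q(s)-P(s)B(s)R(s)^{-1}B(s)^\top P(s)=0,\quad s\in[0,T),\qquad \lim_{s\to T}\min\sigma(P(s))=\infty,$$ admits a unique solution $P\in C([0,T);\mathbb{S}^n_+)$, and the Riccati equation $$\dot\Pi(s)+\Pi(s)A(s)+A(s)^\top\Pi(s)-Q(s)+\Pi(s)B(s)R(s)^{-1}B(s)^\top\Pi(s)=0,\quad s\in(t,T],\qquad \lim_{s\to t}\min\sigma(\Pi(s))=\infty,$$ admits a unique solution $\Pi\in C((t,T];\mathbb{S}^n_+)$.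
   Context: $\mathbb{S}^n$ is the space of symmetric real $n\times n$ matrices, $\mathbb{S}^n_+$ the set of symmetric positive definite ones; inequalities between symmetric matrices are in the positive semidefinite order. $\sigma(M)$ is the spectrum of the matrix $M$. Solutions of differential equations with integrable coefficients are understood in the Carathéodory sense: the function is absolutely continuous on compact subintervals and satisfies the equation a.e. The system $[A,B]$ is completely controllable if for every $0\le t_0<t_1\le T$ and all $x,y\in\mathbb{R}^n$ there is $u\in L^2(t_0,t_1;\mathbb{R}^m)$ such that the solution of $\dot X(s)=A(s)X(s)+B(s)u(s)$ on $[t_0,t_1]$ with $X(t_0)=x$ satisfies $X(t_1)=y$. *)

(* Defs.v *)
From HB Require Import structures.
From mathcomp Require Import all_boot all_order all_algebra.
From mathcomp Require Import all_classical all_reals all_analysis.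
Set Implicit Arguments.
Unset Strict Implicit.
Unset Printing Implicit Defensive.
Import Order.TTheory GRing.Theory Num.Theory.
Import numFieldNormedType.Exports.
Local Open Scope classical_set_scope.
Local Open Scope ring_scope.

Definition quad_form (K : realType) (n : nat) (M : 'M[K]_n) (v : 'cV[K]_n) : K :=
  (v^T *m M *m v) ord0 ord0.

Definition psd_le (K : realType) (n : nat) (M N : 'M[K]_n) : Prop :=
  forall v : 'cV[K]_n, quad_form M v <= quad_form N v.

Definition sym_posdef (K : realType) (n : nat) (M : 'M[K]_n) : Prop :=
  M^T = M /\ forall v : 'cV[K]_n, v != 0 -> 0 < quad_form M v.

(* Only used for symmetric M with n > 0: all eigenvalues are then real and the
   spectrum is finite and nonempty, so that this infimum is a minimum. *)
Definition min_spectrum (K : realType) (n : nat) (M : 'M[K]_n) : K :=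
  inf [set l : K | eigenvalue M l].

(* Membership in L^p(D), entrywise. Functions are total; their values outside D
   are discarded by the extension by zero [_ \_ D]. *)
Definition Lp_mx (K : realType) (p : \bar K) (D : set K) (k l : nat)
    (F : K -> 'M[K]_(k, l)) : Prop :=
  forall i j, (fun s => F s i j) \_ D \in Lfun (@lebesgue_measure K) p.

Definition ae_on (K : realType) (D : set K) (E : K -> Prop) : Prop :=
  {ae (@lebesgue_measure K), forall s, D s -> E s}.

Definition abs_continuous (K : realType) (k l : nat) (a b : K)
    (X : K -> 'M[K]_(k, l)) : Prop :=
  forall e : K, 0 < e -> exists2 d : K, 0 < d &
    forall (N : nat) (u v : 'I_N -> K),
      (forall i, a <= u i /\ u i <= v i /\ v i <= b) ->
      trivIset [set: 'I_N] (fun i => `]u i, v i[%classic) ->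
      \sum_(i < N) (v i - u i) < d ->
      \sum_(i < N) `|X (v i) - X (u i)| < e.

(* Caratheodory solutions on the interval J of an equation
   E s (X s) (X' s). *)
Definition caratheodory_solution (K : realType) (k l : nat) (J : set K)
    (E : K -> 'M[K]_(k, l) -> 'M[K]_(k, l) -> Prop)
    (X : K -> 'M[K]_(k, l)) : Prop :=
  (forall a b : K, a <= b -> `[a, b]%classic `<=` J -> abs_continuous a b X) /\
  ae_on J (fun s => derivable X s 1 /\ E s (X s) (derive1 X s)).

Definition completely_controllable (K : realType) (n m : nat) (T : K)
    (A : K -> 'M[K]_n) (B : K -> 'M[K]_(n, m)) : Prop :=
  forall t0 t1 : K, 0 <= t0 -> t0 < t1 -> t1 <= T ->
  forall x y : 'cV[K]_n,
  exists u : K -> 'cV[K]_m, Lp_mx 2%:E `]t0, t1[%classic u /\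
  exists X : K -> 'cV[K]_n,
    [/\ caratheodory_solution `[t0, t1]%classic
          (fun s Xs dXs => dXs = A s *m Xs + B s *m u s) X,
        X t0 = x & X t1 = y].

(* Elements of C(J; S^n_+). *)
Definition continuous_posdef (K : realType) (n : nat) (J : set K)
    (P : K -> 'M[K]_n) : Prop :=
  {within J, continuous P} /\ forall s, J s -> sym_posdef (P s).

Definition riccati_P (K : realType) (n m : nat) (T : K)
    (A : K -> 'M[K]_n) (B : K -> 'M[K]_(n, m)) (Q : K -> 'M[K]_n)
    (R : K -> 'M[K]_m) (P : K -> 'M[K]_n) : Prop :=
  [/\ continuous_posdef `[0, T[%classic P,
      caratheodory_solution `[0, T[%classic
        (fun s Ps dPs => dPs + Ps *m A s + (A s)^T *m Ps + Q s
           - Ps *m B s *m invmx (R s) *m (B s)^T *m Ps = 0) P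
    & min_spectrum (P s) @[s --> T^'-] --> +oo].

Definition riccati_Pi (K : realType) (n m : nat) (t T : K)
    (A : K -> 'M[K]_n) (B : K -> 'M[K]_(n, m)) (Q : K -> 'M[K]_n)
    (R : K -> 'M[K]_m) (Pi : K -> 'M[K]_n) : Prop :=
  [/\ continuous_posdef `]t, T]%classic Pi,
      caratheodory_solution `]t, T]%classic
        (fun s Pis dPis => dPis + Pis *m A s + (A s)^T *m Pis - Q s
           + Pis *m B s *m invmx (R s) *m (B s)^T *m Pis = 0) Pi
    & min_spectrum (Pi s) @[s --> t^'+] --> +oo].

(* Uniqueness is that of functions on J, values outside J being irrelevant. *)
Definition exists_unique_on (K : realType) (n : nat) (J : set K)
    (S : (K -> 'M[K]_n) -> Prop) : Prop :=
  exists P, S P /\ forall P', S P' -> forall s, J s -> P' s = P s.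

(* Main.v *)
Require Import Defs.
From HB Require Import structures.
From mathcomp Require Import all_boot all_order all_algebra.
From mathcomp Require Import all_classical all_reals all_analysis.
From mathcomp Require Import measurable_realfun ring lra.
Import Order.TTheory GRing.Theory Num.Theory.
Import numFieldNormedType.Exports.
Local Open Scope classical_set_scope.
Local Open Scope ring_scope.
Set Implicit Arguments.
Unset Strict Implicit.
Unset Printing Implicit Defensive.

(* Write S = B R^-1 B^T, let s0 be the blow-up end point and sg = -1 for P
   (s0 = T), sg = 1 for Pi (s0 = t); both equations then read
     P' = sg Q - A^T P - P A - sg P S P.
   Let (X, Y) solve the linear Hamiltonian system
     X' = - A^T X + sg Q Y,  Y' = A Y + sg S X,  X(s0) = 1,  Y(s0) = 0.
   Then X^T Y is symmetric, vanishes at s0, and sg (X^T Y)' = Y^T Q Y + X^T S X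
   is nonnegative; if c^T X^T Y c = 0 away from s0, then Q Y c = 0 and S X c = 0
   in between, so that p = X c solves p' = - A^T p with B^T p = 0, and complete
   controllability forces c = p(s0) = 0.  Hence X^T Y is positive definite away
   from s0, Y is invertible there, and P = X Y^-1 is a solution.
   If P is any solution and W = P^-1, then W -> 0 at s0 and Z = Y - W X solves
   the linear equation Z' = (A - sg W Q) Z with integrable coefficients and
   Z -> 0 at s0; hence Z = 0 and P = X Y^-1.
   Uniqueness for linear equations uses the flow of the adjoint equation in
   place of Gronwall's inequality, and the fundamental theorem of calculus for
   absolutely continuous functions is only needed in the form "f' >= 0 almost
   everywhere implies f nondecreasing". *)

(** * Absolute continuity *)

(** Blow-up at s0 is not an initial condition for P, but the inverse W = P^-1 tends to 0 there.
    Writing W = Y X^-1 turns this into the regular data X(s0) = 1, Y(s0) = 0 of a linear system, and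
    existence of P on the whole interval reduces to invertibility of Y away from s0. For uniqueness,
    W satisfies a Riccati equation of its own. In Y - W X the inhomogeneous terms cancel, and one of
    the two factors W of the quadratic term is absorbed into the coefficient A - sg W Q. Since W
    stays bounded up to s0, this coefficient is integrable on the whole interval, whereas P is
    unbounded there. The coefficients are merely integrable and their properties hold almost
    everywhere. They are extended by zero outside the interval, so that primitives can be taken from
    minus infinity and linear solutions exist on the whole line. *)

(** The supremum of the points where [G] holds is reached and then passed by one step. The radius
    depends on [x] alone, and [G] is carried across [x] from any nearby [y] to any nearby [z], so
    [G x] may assert the existence of data collected on [a, x]. *)
Lemma real_induction (K : realType) (a b : K) (G : K -> Prop) : a <= b -> G a ->
  (forall x, a <= x <= b -> exists2 r, 0 < r & forall y z,
     a <= y -> y <= x -> x <= z -> z <= b -> x - y < r -> z - x < r ->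
     G y -> G z) -> G b.
Proof.
move=> ab Ga step.
pose E := [set x | a <= x <= b /\ G x].
have Ea : E a by split; rewrite ?lexx.
have supE : has_sup E.
  by split; [exists a | exists b => x [/andP[]]].
have ac : a <= sup E by apply: ub_le_sup => //; exact: supE.2.
have cb : sup E <= b by apply: ge_sup; [exists a | move=> x [/andP[]]].
have acb : a <= sup E <= b by rewrite ac cb.
have [r r0 rG] := step _ acb.
have [y [/andP[ay yb] Gy] ry] := sup_adherent r0 supE.
have yc : y <= sup E by apply: ub_le_sup => //; [exact: supE.2|split; rewrite ?ay].
pose z := Num.min b (sup E + r / 2).
have cz : sup E <= z by rewrite le_min cb lerDl divr_ge0// ltW.
have zb : z <= b by rewrite ge_min lexx.
have Gz : G z.
  apply: (rG y) => //; first by lra.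
  by rewrite ltrBlDr /z gt_min; apply/orP; right; lra.
have zE : z <= sup E.
  apply: ub_le_sup; first exact: supE.2.
  by split => //; rewrite (le_trans ac cz).
suff <- : z = b by [].
move: zE cz; rewrite /z /Num.min; case: ifP => // _.
by lra.
Qed.

(** Absolute continuity with an arbitrary weight of an interval in place of [|f v - f u|], so that
    entries, matrix norms and products can be compared interval by interval. *)
Definition small_increments (K : realType) (a b : K) (w : K -> K -> K) :=
  forall e : K, 0 < e -> exists2 d : K, 0 < d &
    forall (N : nat) (u v : 'I_N -> K),
      (forall i, a <= u i /\ u i <= v i /\ v i <= b) ->
      trivIset [set: 'I_N] (fun i => `]u i, v i[%classic) ->
      \sum_(i < N) (v i - u i) < d ->
      \sum_(i < N) w (u i) (v i) < e.

Section small_increments_theory.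
Variables (K : realType) (a b : K).
Implicit Types w : K -> K -> K.

Lemma small_incr_le w1 w2 :
  (forall u v, a <= u -> u <= v -> v <= b -> w1 u v <= w2 u v) ->
  small_increments a b w2 -> small_increments a b w1.
Proof.
move=> le12 h2 e /h2[d d0 dP]; exists d => // N u v uv tI /(dP N u v uv tI).
by apply: le_lt_trans; apply: ler_sum => i _; apply: le12; have [? []] := uv i.
Qed.

Lemma small_incrD w1 w2 : small_increments a b w1 -> small_increments a b w2 ->
  small_increments a b (fun u v => w1 u v + w2 u v).
Proof.
move=> h1 h2 e e0.
have [d1 d10 P1] := h1 (e / 2) ltac:(lra).
have [d2 d20 P2] := h2 (e / 2) ltac:(lra).
exists (Num.min d1 d2); first by rewrite lt_min d10.
move=> N u v uv tI; rewrite lt_min => /andP[s1 s2]; rewrite big_split/=.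
have := P1 N u v uv tI s1; have := P2 N u v uv tI s2; lra.
Qed.

Lemma small_incr0 : small_increments a b (fun _ _ => 0).
Proof. by move=> e e0; exists 1 => // N u v _ _ _; rewrite big1. Qed.

Lemma small_incr_sum (I : Type) (r : seq I) (w : I -> K -> K -> K) :
  (forall i, small_increments a b (w i)) ->
  small_increments a b (fun u v => \sum_(i <- r) w i u v).
Proof.
move=> h; elim: r => [|i r IH].
  by apply: small_incr_le small_incr0 => u v _ _ _; rewrite big_nil.
apply: small_incr_le (small_incrD (h i) IH) => u v _ _ _.
by rewrite big_cons.
Qed.

Lemma small_incrZ w c : 0 <= c -> small_increments a b w ->
  small_increments a b (fun u v => c * w u v).
Proof.
move=> c0 h e e0; have c1 : 0 < c + 1 by lra.
have [d d0 P] := h (e / (c + 1)) ltac:(exact: divr_gt0).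
exists d => // N u v uv tI s; rewrite -mulr_sumr.
have := P N u v uv tI s; rewrite ltr_pdivlMr// => {}P.
(* The weight carries no sign, so a negative sum is treated apart. *)
have [S0|S0] := leP 0 (\sum_(i < N) w (u i) (v i)); first by nra.
by apply: le_lt_trans e0; rewrite mulr_ge0_le0// ltW.
Qed.

Lemma small_incr_unif w : small_increments a b w ->
  forall e, 0 < e -> exists2 d, 0 < d &
  forall u v, a <= u -> u <= v -> v <= b -> v - u < d -> w u v < e.
Proof.
move=> h e /h[d d0 P]; exists d => // u v au uv vb vud.
have := P 1 (fun=> u) (fun=> v); rewrite !big_ord1; apply => //.
by move=> i j _ _ _; rewrite !ord1.
Qed.

End small_increments_theory.

Lemma small_incr_subitv (K : realType) (a b c d : K) w : a <= c -> d <= b ->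
  small_increments a b w -> small_increments c d w.
Proof.
move=> ac db h e /h[r r0 P]; exists r => // N u v uv; apply: P => i.
by have [? []] := uv i; lra.
Qed.

Definition ac (K : realType) (a b : K) (f : K -> K) :=
  small_increments a b (fun u v => `|f v - f u|).

Section ac_theory.
Variables (K : realType) (a b : K).
Implicit Types f g : K -> K.

Lemma ac_bounded f : ac a b f -> exists2 C, 0 <= C &
  forall s, a <= s <= b -> `|f s| <= C.
Proof.
move=> /small_incr_unif h.
have [ba|ab] := ltP b a.
  by exists 0 => // s /andP[as_ sb]; move: (le_trans as_ sb); rewrite leNgt ba.
have [d d0 P] := h _ ltr01.
suff : exists2 C, 0 <= C & forall s, a <= s <= b -> `|f s| <= C by [].
apply: (@real_induction K a b (fun x => exists2 C, 0 <= C &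
  forall s, a <= s <= x -> `|f s| <= C)) => //.
  by exists `|f a| => // s; rewrite -eq_le => /eqP ->.
(* With radius d/2, points on either side of [x] are less than [d] apart, so [f] varies by less than
   1 between [y] and [z]. *)
move=> x /andP[ax xb]; exists (d/2); first by lra.
move=> y z ay yx xz zb xy zx [C C0 HC]; exists (C + `|f y| + 1).
  by rewrite !addr_ge0.
move=> s /andP[as_ sz]; have [sy|ys] := leP s y.
  by have := HC s; rewrite as_ sy => /(_ isT); have := normr_ge0 (f y); lra.
have := P y s ay (ltW ys) ltac:(lra) ltac:(lra).
have := ler_normD (f s - f y) (f y); rewrite subrK; lra.
Qed.

Lemma acD f g : ac a b f -> ac a b g -> ac a b (fun s => f s + g s).
Proof.
move=> hf hg; apply: small_incr_le (small_incrD hf hg) => u v _ _ _.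
by rewrite opprD addrACA ler_normD.
Qed.

Lemma acM f g : ac a b f -> ac a b g -> ac a b (fun s => f s * g s).
Proof.
move=> hf hg; have [C C0 fC] := ac_bounded hf; have [D D0 gD] := ac_bounded hg.
apply: small_incr_le (small_incrD (small_incrZ D0 hf) (small_incrZ C0 hg)).
move=> u v au uv vb.
have -> : f v * g v - f u * g u = (f v - f u) * g v + f u * (g v - g u).
  by ring.
apply: le_trans (ler_normD _ _) _; rewrite !normrM lerD//.
  by rewrite mulrC ler_wpM2r// gD// vb (le_trans au uv).
by rewrite ler_wpM2r// fC// au (le_trans uv vb).
Qed.

Lemma ac_cst c : ac a b (fun=> c).
Proof.
apply: small_incr_le (@small_incr0 _ a b) => u v _ _ _.
by rewrite subrr normr0.
Qed.

End ac_theory.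

Lemma lebesgue_measure_oo (K : realType) (u v : K) : u <= v ->
  (@lebesgue_measure K) `]u, v[%classic = (v - u)%:E.
Proof.
move=> uv; rewrite lebesgue_measure_itv/=; case: ifPn => //.
rewrite lte_fin -leNgt => vu.
by have -> : u = v; [apply/eqP; rewrite eq_le uv vu|rewrite subrr].
Qed.

Lemma sum_length_le (K : realType) (N : nat) (u v : 'I_N -> K) (U : set K) :
  (forall i, u i <= v i) -> trivIset [set: 'I_N] (fun i => `]u i, v i[%classic) ->
  (forall i, `]u i, v i[%classic `<=` U) -> measurable U ->
  ((\sum_(i < N) (v i - u i))%:E <= (@lebesgue_measure K) U)%E.
Proof.
move=> uv tI sub mU; rewrite -sumEFin.
rewrite (eq_bigr (fun i => (@lebesgue_measure K) `]u i, v i[%classic)); last first.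
  by move=> i _; rewrite lebesgue_measure_oo.
rewrite -measure_semi_additive_ord//.
- apply: le_measure; rewrite ?inE//.
    by apply: bigsetU_measurable => i _; exact: measurable_itv.
  by move=> x; rewrite -bigcup_seq => -[i _]; exact: sub.
- by apply: bigsetU_measurable => i _; exact: measurable_itv.
Qed.

Lemma is_derive_near (K : realType) (f : K -> K) (x g : K) :
  is_derive x 1 f g -> forall e, 0 < e -> exists2 r, 0 < r &
  forall y, `|y - x| < r -> `|f y - f x - g * (y - x)| <= e * `|y - x|.
Proof.
move=> [df fg] e e0; move: df => /cvg_ex[l lf].
have lg : l = g by rewrite -fg; apply/esym/cvg_lim.
move: lf; rewrite lg => /cvgrPdist_le/(_ _ e0)[r /= r0 rP].
exists r => // y yx; have [->|nyx] := eqVneq y x.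
  by rewrite !subrr mulr0 subrr normr0 mulr0.
have h0 : y - x != 0 by rewrite subr_eq0.
have := rP (y - x); rewrite /= sub0r normrN => /(_ yx h0).
rewrite /GRing.scale/= mulr1 subrK.
have p : 0 < `|y - x| by rewrite normr_gt0.
rewrite -(ler_pM2r p) -normrM mulrBl mulrAC mulVf// mul1r.
by rewrite -normrN opprB.
Qed.

(* Real induction (Cousin's lemma) along [a, b]: intervals tagged by a point of
   the exceptional null set lie in an open set of small measure. *)
Lemma ac_nondecreasing (K : realType) (a b : K) (f : K -> K) : a <= b -> ac a b f ->
  {ae (@lebesgue_measure K), forall s, a < s < b ->
     exists2 g, 0 <= g & is_derive s 1 f g} ->
  f a <= f b.
Proof.
move=> ab acf [M [mM M0 ME]].
(* The end points join the exceptional set because the derivative is only controlled strictly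
   inside. *)
pose N := M `|` [set a; b].
have mN : measurable N by apply: measurableU => //; apply: measurableU.
have N0 : (@lebesgue_measure K) N = 0%E.
  rewrite null_set_setU//; first by apply: measurableU.
  rewrite null_set_setU//; [exact: lebesgue_measure_set1|exact: lebesgue_measure_set1].
(* The loss is e (b - a) over points of differentiability, plus e over the intervals covering the
   exceptional set. *)
suff main e : 0 < e -> f a <= f b + e * (b - a + 1).
  have ba1 : 0 < b - a + 1 by lra.
  apply/ler_addgt0Pr => e e0; have := main (e / (b - a + 1)) (divr_gt0 e0 ba1).
  by rewrite divfK// gt_eqF.
move=> e0; have [d d0 dP] := acf e e0.
have [|U [oU NU Ud]] := lebesgue_regularity_outer mN _ d0.
  by rewrite -[ltLHS]/((@lebesgue_measure K) N) N0.
have mU : measurable U by exact: measurable_realfun.open_measurable.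
(* Outer regularity bounds the measure of U minus N; as N is null, the same bound holds for U. *)
have {}Ud : ((@lebesgue_measure K) U < d%:E)%E.
  have mUN : measurable (U `\` N) by exact: measurableD.
  have : ((@lebesgue_measure K) U <=
      (@lebesgue_measure K) (U `\` N) + (@lebesgue_measure K) N)%E.
    rewrite -[X in ((@lebesgue_measure K) X <= _)%E](setDUK NU) setUC.
    exact: measureU2.
  by rewrite N0 adde0 => /le_lt_trans; apply.
(* Up to [x], the decrease of [f] is paid for by slope [e] and by the increments over finitely many
   disjoint intervals inside U. *)
pose G x := exists n (u v : 'I_n -> K),
  [/\ forall i, a <= u i /\ u i <= v i /\ v i <= x,
      trivIset [set: 'I_n] (fun i => `]u i, v i[%classic),
      (forall i, `]u i, v i[%classic `<=` U) &
      f a - f x <= e * (x - a) + \sum_(i < n) `|f (v i) - f (u i)|].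
suff [n [u [v [uv tI sub fab]]]] : G b.
  have : \sum_(i < n) (v i - u i) < d.
    rewrite -lte_fin; apply: le_lt_trans Ud; apply: sum_length_le => // i.
    by have [_ []] := uv i.
  by move=> /(dP n u v uv tI); nra.
apply: (real_induction ab).
  exists 0%N, (fun=> a), (fun=> a); split; [by case|by case|by case|].
  by rewrite big_ord0 !subrr mulr0 addr0.
move=> x axb.
have [Nx|Nx] := pselect (N x).
  have /nbhs_ballP[r /= r0 rU] : nbhs x U.
    by apply: open_nbhs_nbhs; split => //; exact: NU.
  exists r => // y z ay yx xz zb xyr zxr [n [u [v [uv tI sub fay]]]].
  (* [cat w t] appends [t] to the family [w]. The new interval ]y, z[ lies beyond the earlier ones,
     which all end at or before [y]. *)
  pose cat (w : 'I_n -> K) t (i : 'I_n.+1) := if unlift ord_max i is Some j then w j else t.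
  have catl w t j : cat w t (lift ord_max j) = w j by rewrite /cat liftK.
  have catr w t : cat w t ord_max = t by rewrite /cat unlift_none.
  exists n.+1, (cat u y), (cat v z); split.
  - move=> i; case: (unliftP ord_max i) => [j|] ->; rewrite ?catl ?catr.
      by have [? [? ?]] := uv j; split => //; split => //; lra.
    by split => //; split => //; lra.
  - have dis (j : 'I_n) t : `]u j, v j[%classic t -> `]y, z[%classic t -> False.
      rewrite /= !in_itv/= => /andP[_ tv] /andP[yt _].
      by have [_ [_ vy]] := uv j; lra.
    move=> i k _ _; case: (unliftP ord_max i) => [j|] ->;
      case: (unliftP ord_max k) => [l|] ->; rewrite ?catl ?catr => -[t [t1 t2]].
    + by congr lift; apply: tI => //; exists t.
    + by case: (dis j t).
    + by case: (dis l t).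
    + by [].
  - move=> i; case: (unliftP ord_max i) => [j|] ->; rewrite ?catl ?catr//.
    move=> t; rewrite /= in_itv/= => /andP[yt tz]; apply: rU => /=.
    by rewrite /ball/= ltr_norml; apply/andP; split; lra.
  - rewrite big_ord_recr/= !catr.
    rewrite (eq_bigr (fun i => `|f (v i) - f (u i)|)); last first.
      move=> i _; have -> : widen_ord (leqnSn n) i = lift ord_max i.
        by apply/val_inj; rewrite /= /bump leqNgt ltn_ord.
      by rewrite !catl.
    have := ler_norm (- (f z - f y)); rewrite normrN.
    by nra.
have nMx : ~ M x by move=> ?; apply: Nx; left.
have axb' : a < x < b.
  move/andP: axb => [ax xb]; rewrite !lt_neqAle ax xb !andbT.
  by apply/andP; split; apply/negP => /eqP E; apply: Nx; right; [left|right].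
have [g g0 fg] : exists2 g, 0 <= g & is_derive x 1 f g.
  apply: contrapT => H; apply: nMx; apply: ME => /= /(_ axb').
  exact: H.
(* As g >= 0, [f] decreases by at most e (z - y) from [y] to [z], which the term e (x - a)
   absorbs. *)
have [r r0 rP] := is_derive_near fg e0.
exists r => // y z ay yx xz zb xyr zxr [n [u [v [uv tI sub fay]]]].
exists n, u, v; split => //.
  by move=> i; have [? [? ?]] := uv i; split => //; split => //; lra.
have := rP y; rewrite distrC ger0_norm ?subr_ge0// => /(_ xyr).
have := rP z; rewrite (ger0_norm (_ : 0 <= z - x)) ?subr_ge0// => /(_ zxr).
rewrite !ler_norml => /andP[h1 _] /andP[_ h2].
have : 0 <= g * (z - x) by rewrite mulr_ge0// subr_ge0.
have : 0 <= g * (x - y) by rewrite mulr_ge0// subr_ge0.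
lra.
Qed.

(** * Caratheodory primitives *)

Lemma ae_imp (K : realType) (P Q : K -> Prop) : (forall x, P x -> Q x) ->
  {ae (@lebesgue_measure K), forall x, P x} ->
  {ae (@lebesgue_measure K), forall x, Q x}.
Proof.
move=> PQ; apply: filterS => //.
exact: (ae_filter_ringOfSetsType (@lebesgue_measure K)).
Qed.

Lemma ae_imp2 (K : realType) (P1 P2 Q : K -> Prop) :
  (forall x, P1 x -> P2 x -> Q x) ->
  {ae (@lebesgue_measure K), forall x, P1 x} ->
  {ae (@lebesgue_measure K), forall x, P2 x} ->
  {ae (@lebesgue_measure K), forall x, Q x}.
Proof.
move=> PQ; apply: filterS2 => //.
exact: (ae_filter_ringOfSetsType (@lebesgue_measure K)).
Qed.

Lemma ae_forall (K : realType) (I : finType) (P : I -> K -> Prop) :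
  (forall i, {ae (@lebesgue_measure K), forall x, P i x}) ->
  {ae (@lebesgue_measure K), forall x, forall i, P i x}.
Proof.
move=> h.
exact: (@filter_forall _ I P _ (ae_filter_ringOfSetsType (@lebesgue_measure K)) h).
Qed.

(** Primitives are characterised by absolute continuity and the almost everywhere derivative instead
    of an integral; sums, products and inverses then follow the rules of differentiation. *)
Definition prim (K : realType) (a b : K) (f g : K -> K) :=
  ac a b f /\
  {ae (@lebesgue_measure K), forall s, a < s < b -> is_derive s 1 f (g s)}.

Section prim_theory.
Variables (K : realType) (a b : K).
Implicit Types f g : K -> K.
Notation mu := (@lebesgue_measure K).

Lemma prim_subitv c d f g : a <= c -> d <= b -> prim a b f g -> prim c d f g.
Proof.
move=> ac db [h1 h2]; split; first exact: small_incr_subitv h1.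
by apply: ae_imp h2 => s h /andP[cs sd]; apply: h; lra.
Qed.

Lemma prim_ae f g1 g2 : {ae mu, forall s, a < s < b -> g1 s = g2 s} ->
  prim a b f g1 -> prim a b f g2.
Proof.
move=> e [h1 h2]; split => //; apply: ae_imp2 e h2 => s e h ab.
by rewrite -e//; exact: h.
Qed.

Lemma prim_eq f g1 g2 : (forall s, a < s < b -> g1 s = g2 s) ->
  prim a b f g1 -> prim a b f g2.
Proof. by move=> e; apply: prim_ae; apply: aeW. Qed.

Lemma prim_cst c : prim a b (fun=> c) (fun=> 0).
Proof. by split; [exact: ac_cst|apply: aeW => s _; exact: is_derive_cst]. Qed.

Lemma primD f1 f2 g1 g2 : prim a b f1 g1 -> prim a b f2 g2 ->
  prim a b (fun s => f1 s + f2 s) (fun s => g1 s + g2 s).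
Proof.
move=> [h1 k1] [h2 k2]; split; first exact: acD.
by apply: ae_imp2 k1 k2 => s k1 k2 ab; apply: is_deriveD; [exact: k1|exact: k2].
Qed.

Lemma primM f1 f2 g1 g2 : prim a b f1 g1 -> prim a b f2 g2 ->
  prim a b (fun s => f1 s * f2 s) (fun s => g1 s * f2 s + f1 s * g2 s).
Proof.
move=> [h1 k1] [h2 k2]; split; first exact: acM.
apply: ae_imp2 k1 k2 => s k1 k2 ab.
have := is_deriveM (k1 ab) (k2 ab).
by rewrite /GRing.scale/= addrC [f2 s * _]mulrC.
Qed.

Lemma primZ c f g : prim a b f g -> prim a b (fun s => c * f s) (fun s => c * g s).
Proof.
move=> h; apply: prim_eq (primM (prim_cst c) h) => s _.
by rewrite mul0r add0r.
Qed.

Lemma primB f1 f2 g1 g2 : prim a b f1 g1 -> prim a b f2 g2 ->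
  prim a b (fun s => f1 s - f2 s) (fun s => g1 s - g2 s).
Proof.
move=> h1 h2; have := primD h1 (primZ (-1) h2).
by under eq_fun do rewrite mulN1r; under [X in prim _ _ _ X]eq_fun do rewrite mulN1r.
Qed.

Lemma prim_sum (I : Type) (r : seq I) (f g : I -> K -> K) :
  (forall i, prim a b (f i) (g i)) ->
  prim a b (fun s => \sum_(i <- r) f i s) (fun s => \sum_(i <- r) g i s).
Proof.
move=> h; elim: r => [|i r IH].
  under eq_fun do rewrite big_nil; under [X in prim _ _ _ X]eq_fun do rewrite big_nil.
  exact: prim_cst.
under eq_fun do rewrite big_cons; under [X in prim _ _ _ X]eq_fun do rewrite big_cons.
exact: primD.
Qed.

Lemma prim_nondecreasing f g c d : prim a b f g ->
  {ae mu, forall s, a < s < b -> 0 <= g s} ->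
  a <= c -> c <= d -> d <= b -> f c <= f d.
Proof.
move=> [h k] g0 ac cd db; apply: ac_nondecreasing => //.
  exact: small_incr_subitv h.
apply: ae_imp2 k g0 => s k g0 /andP[cs sd].
have sab : a < s < b by lra.
by exists (g s); [exact: g0|exact: k].
Qed.

End prim_theory.

Definition mprim (K : realType) (k l : nat) (a b : K) (X G : K -> 'M[K]_(k, l)) :=
  forall i j, prim a b (fun s => X s i j) (fun s => G s i j).

Section mprim_theory.
Variables (K : realType) (a b : K).
Notation mu := (@lebesgue_measure K).

Lemma mprim_subitv k l c d (X G : K -> 'M[K]_(k, l)) : a <= c -> d <= b ->
  mprim a b X G -> mprim c d X G.
Proof. by move=> ac db h i j; exact: prim_subitv (h i j). Qed.

Lemma mprim_ae k l (X G1 G2 : K -> 'M[K]_(k, l)) :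
  {ae mu, forall s, a < s < b -> G1 s = G2 s} ->
  mprim a b X G1 -> mprim a b X G2.
Proof.
move=> e h i j; apply: prim_ae (h i j).
by apply: ae_imp e => s e ab; rewrite e.
Qed.

Lemma mprim_eq k l (X G1 G2 : K -> 'M[K]_(k, l)) :
  (forall s, a < s < b -> G1 s = G2 s) ->
  mprim a b X G1 -> mprim a b X G2.
Proof. by move=> e; apply: mprim_ae; apply: aeW. Qed.

Lemma mprim_cst k l (C : 'M[K]_(k, l)) : mprim a b (fun=> C) (fun=> 0).
Proof.
by move=> i j; under [X in prim _ _ _ X]eq_fun do rewrite mxE; exact: prim_cst.
Qed.

Lemma mprimB k l (X1 X2 G1 G2 : K -> 'M[K]_(k, l)) :
  mprim a b X1 G1 -> mprim a b X2 G2 ->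
  mprim a b (fun s => X1 s - X2 s) (fun s => G1 s - G2 s).
Proof.
move=> h1 h2 i j; under eq_fun do rewrite !mxE.
by under [X in prim _ _ _ X]eq_fun do rewrite !mxE; exact: primB.
Qed.

Lemma mprim_tr k l (X G : K -> 'M[K]_(k, l)) :
  mprim a b X G -> mprim a b (fun s => (X s)^T) (fun s => (G s)^T).
Proof.
move=> h i j; under eq_fun do rewrite mxE.
by under [X in prim _ _ _ X]eq_fun do rewrite mxE; exact: h.
Qed.

Lemma mprimM k l p (X1 G1 : K -> 'M[K]_(k, l)) (X2 G2 : K -> 'M[K]_(l, p)) :
  mprim a b X1 G1 -> mprim a b X2 G2 ->
  mprim a b (fun s => X1 s *m X2 s) (fun s => G1 s *m X2 s + X1 s *m G2 s).
Proof.
move=> h1 h2 i j; under eq_fun do rewrite mxE.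
under [X in prim _ _ _ X]eq_fun do rewrite !mxE -big_split/=.
by apply: prim_sum => x; exact: primM.
Qed.

Lemma mprim_const k l (X G : K -> 'M[K]_(k, l)) c d : mprim a b X G ->
  {ae mu, forall s, a < s < b -> G s = 0} ->
  a <= c -> c <= d -> d <= b -> X c = X d.
Proof.
move=> h G0 ac cd db; apply/matrixP => i j; apply/eqP; rewrite eq_le.
apply/andP; split.
  apply: (prim_nondecreasing (h i j)) => //.
  by apply: ae_imp G0 => s e /e ->; rewrite mxE.
rewrite -lerN2; have := primZ (-1) (h i j).
under eq_fun do rewrite mulN1r; move=> h'.
apply: (prim_nondecreasing h') => //.
by apply: ae_imp G0 => s e /e ->; rewrite mxE mulr0.
Qed.

Lemma mprim_bounded k l (X G : K -> 'M[K]_(k, l)) : mprim a b X G ->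
  exists2 C, 0 <= C & forall s i j, a <= s <= b -> `|X s i j| <= C.
Proof.
move=> h.
have /choice[C CP] : forall ij : 'I_k * 'I_l, exists C, 0 <= C /\
    forall s, a <= s <= b -> `|X s ij.1 ij.2| <= C.
  by move=> [i j]; have [C C0 CP] := ac_bounded (h i j).1; exists C.
exists (\sum_ij C ij); first by apply: sumr_ge0 => ij _; exact: (CP ij).1.
move=> s i j sab; rewrite (bigD1 (i, j))//=.
apply: le_trans ((CP (i, j)).2 s sab) _; rewrite lerDl.
by apply: sumr_ge0 => ij _; exact: (CP ij).1.
Qed.

End mprim_theory.

(** * Indefinite integrals *)

Section indefinite_integral.
Variable K : realType.
Notation mu := (@lebesgue_measure K).
Implicit Types f : K -> K.

(** Integrating from minus infinity gives one function for all intervals; it vanishes at [a] as soon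
    as [f] is zero up to [a]. *)
Definition primitive f (x : K) : K := (\int[mu]_(t in `]-oo, x]) f t)%R.

Lemma primitiveB f (u v : K) : mu.-integrable setT (EFin \o f) -> u <= v ->
  primitive f v - primitive f u = (\int[mu]_(t in `]u, v[) f t)%R.
Proof.
move=> fi uv; rewrite /primitive Rintegral_itvB//; last exact: integrableS fi.
by rewrite Rintegral_itv_bndo_bndc//; exact: integrableS fi.
Qed.

(** Absolute continuity of the integral as a set function, applied to the union of the disjoint
    intervals. *)
Lemma ac_primitive f (a b : K) : mu.-integrable setT (EFin \o f) ->
  ac a b (primitive f).
Proof.
move=> fi e e0; have [d [d0 dP]] := integral_normr_continuous fi e0.
exists d => // N u v uv tI uvd.
have uv' i : u i <= v i by have [_ []] := uv i.
pose U := \big[setU/set0]_(i < N) `]u i, v i[%classic.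
have mU : measurable U by apply: bigsetU_measurable => i _; exact: measurable_itv.
have fin : mu.-integrable setT (EFin \o (fun x => `|f x|)).
  exact: (integrable_abse fi).
have muU : (mu U < d%:E)%E.
  rewrite /U measure_semi_additive_ord//.
  rewrite (eq_bigr (fun i => (v i - u i)%:E)); first by rewrite sumEFin lte_fin.
  by move=> i _; exact: lebesgue_measure_oo.
apply: le_lt_trans (dP U mU muU).
have -> : \int[mu]_(x in U) `|f x| = \sum_(i < N) \int[mu]_(x in `]u i, v i[) `|f x|.
  rewrite /Rintegral /U integral_bigsetU_EFin//; last first.
  - case/integrableP: (fin) => mf _.
    exact: (measurable_funS measurableT _ mf).
  - by move=> i j _ _ ij; apply: tI.
  - exact: index_enum_uniq.
  rewrite -sum_fine// => i _.
  by apply: integrable_fin_num => //; exact: integrableS fin.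
apply: ler_sum => i _; rewrite primitiveB//.
by apply: le_normr_Rintegral => //; exact: integrableS fi.
Qed.

Lemma prim_primitive f (a b : K) : mu.-integrable setT (EFin \o f) ->
  prim a b (primitive f) f.
Proof.
move=> fi; split; first exact: ac_primitive.
have lf : locally_integrable setT f by apply: open_integrable_locally => //; exact: openT.
have ify y : mu.-integrable `]-oo, y] (EFin \o f) by exact: integrableS fi.
apply: ae_imp (FTC1Ny ify lf) => s [df f's] _.
by split; [exact: df|rewrite -derive1E; exact: f's].
Qed.

Lemma primitive_eq0 f (a x : K) : (forall s, s <= a -> f s = 0) -> x <= a ->
  primitive f x = 0.
Proof.
move=> f0 xa; rewrite /primitive (@eq_Rintegral _ _ _ _ _ (cst 0)).
  by rewrite /Rintegral integral0.
move=> s; rewrite inE/= in_itv/= => sx.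
by rewrite /= f0// (le_trans sx xa).
Qed.

(** Supplies the measurability of the Picard iterates. *)
Lemma primitive_continuous f : mu.-integrable setT (EFin \o f) ->
  continuous (primitive f).
Proof.
move=> fi x; apply/cvgrPdist_lt => e e0.
have [d d0 dP] := small_incr_unif (@ac_primitive f (x - 1) (x + 1) fi) e0.
near=> y.
have : `|x - y| < Num.min d 1.
  near: y; apply: (@cvgr_dist_lt _ _ _ _ (nbhs_filter x) id x) => //.
  by rewrite lt_min d0 ltr01.
rewrite lt_min !(ltr_norml (x - y)) => /andP[/andP[h1 h2] /andP[h3 h4]].
have [xy|yx] := leP x y; last by apply: (dP y x); lra.
by rewrite distrC; apply: (dP x y); lra.
Unshelve. all: by end_near. Qed.

Lemma primitive_bounded f x : mu.-integrable setT (EFin \o f) ->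
  `|primitive f x| <= (\int[mu]_(t in setT) `|f t|)%R.
Proof.
move=> fi; apply: le_trans (le_normr_Rintegral _ _) _ => //.
  exact: integrableS fi.
have fin : mu.-integrable setT (EFin \o (fun x => `|f x|)).
  exact: (integrable_abse fi).
apply: fine_le.
- by apply: integrable_fin_num => //; exact: integrableS fin.
- by apply: integrable_fin_num.
- apply: ge0_subset_integral => //.
  exact: measurable_int fin.
Qed.

Lemma integrableM_bounded f (h : K -> K) (C : K) : mu.-integrable setT (EFin \o f) ->
  measurable_fun setT h -> (forall x, `|h x| <= C) ->
  mu.-integrable setT (EFin \o (fun x => f x * h x)).
Proof.
move=> fi mh hC; have := integrableMl measurableT fi mh; apply => //.
exists C; split; first exact: num_real.
by move=> y Cy x _; exact: le_trans (hC x) (ltW Cy).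
Qed.

Lemma integrable_sumR (I : Type) (r : seq I) (f : I -> K -> K) :
  (forall i, mu.-integrable setT (EFin \o f i)) ->
  mu.-integrable setT (EFin \o (fun x => \sum_(i <- r) f i x)).
Proof.
move=> h; elim: r => [|i r IH].
  by under eq_fun do rewrite big_nil; exact: integrable0.
under eq_fun do rewrite big_cons.
exact: (integrableD _ (h i) IH).
Qed.

End indefinite_integral.

(** * Inverse matrices *)

Section mx_sum_norm.
Variable K : realType.

(** This norm is submultiplicative, which the largest absolute entry is not, and absolute continuity
    of the entries passes to it by summation. *)
Definition mxn (k l : nat) (M : 'M[K]_(k, l)) : K := \sum_i \sum_j `|M i j|.

Lemma mxn_ge0 k l (M : 'M[K]_(k, l)) : 0 <= mxn M.
Proof. by apply: sumr_ge0 => i _; apply: sumr_ge0. Qed.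

Lemma le_mxn k l (M : 'M[K]_(k, l)) i j : `|M i j| <= mxn M.
Proof.
rewrite /mxn (bigD1 i)//= (bigD1 j)//= -addrA lerDl addr_ge0//.
  exact: sumr_ge0.
by apply: sumr_ge0 => ? _; apply: sumr_ge0.
Qed.

Lemma row_le_mxn k l (M : 'M[K]_(k, l)) i : \sum_j `|M i j| <= mxn M.
Proof.
by rewrite /mxn [leRHS](bigD1 i)//= lerDl; apply: sumr_ge0 => ? _; exact: sumr_ge0.
Qed.

Lemma mxn_le k l (M : 'M[K]_(k, l)) e : (forall i j, `|M i j| <= e) ->
  mxn M <= (k * l)%:R * e.
Proof.
move=> Me; rewrite /mxn.
apply: (@le_trans _ _ (\sum_(i < k) \sum_(j < l) e)).
  by apply: ler_sum => i _; apply: ler_sum => j _.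
by rewrite !sumr_const !card_ord -mulrnA mulnC -[leLHS]mulr_natl.
Qed.

Lemma mxnN k l (M : 'M[K]_(k, l)) : mxn (- M) = mxn M.
Proof. by apply: eq_bigr => i _; apply: eq_bigr => j _; rewrite mxE normrN. Qed.

Lemma mxnZ k l c (M : 'M[K]_(k, l)) : mxn (c *: M) = `|c| * mxn M.
Proof.
rewrite /mxn mulr_sumr; apply: eq_bigr => i _; rewrite mulr_sumr.
by apply: eq_bigr => j _; rewrite mxE normrM.
Qed.

Lemma mxnD k l (M N : 'M[K]_(k, l)) : mxn (M + N) <= mxn M + mxn N.
Proof.
rewrite /mxn -big_split; apply: ler_sum => i _; rewrite -big_split.
by apply: ler_sum => j _; rewrite mxE ler_normD.
Qed.

Lemma mxnM k l p (M : 'M[K]_(k, l)) (N : 'M[K]_(l, p)) :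
  mxn (M *m N) <= mxn M * mxn N.
Proof.
rewrite /mxn mulr_suml; apply: ler_sum => i _.
apply: (@le_trans _ _ (\sum_j \sum_h `|M i h| * `|N h j|)).
  apply: ler_sum => j _; rewrite mxE; apply: le_trans (ler_norm_sum _ _ _) _.
  by apply: ler_sum => h _; rewrite normrM.
rewrite exchange_big/= mulr_suml; apply: ler_sum => h _.
rewrite -mulr_sumr; apply: ler_wpM2l => //.
rewrite (bigD1 h)//= lerDl; apply: sumr_ge0 => ? _; exact: sumr_ge0.
Qed.

Lemma mxn_sub0 k l (M N : 'M[K]_(k, l)) : mxn (M - N) = 0 -> M = N.
Proof.
move=> h; apply/matrixP => i j; apply/eqP; rewrite -subr_eq0 -normr_le0 -h.
by have := le_mxn (M - N) i j; rewrite !mxE.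
Qed.

End mx_sum_norm.

Section mprim_inverse.
Variables (K : realType) (a b : K).
Notation mu := (@lebesgue_measure K).

Lemma mprim_incr k l (X G : K -> 'M[K]_(k, l)) : mprim a b X G ->
  small_increments a b (fun u v => mxn (X v - X u)).
Proof.
move=> h; rewrite /mxn.
apply: (@small_incr_le _ _ _ _ (fun u v => \sum_i \sum_j `|X v i j - X u i j|)).
  move=> u v _ _ _; apply: ler_sum => i _; apply: ler_sum => j _.
  by rewrite !mxE.
apply: small_incr_sum => i; apply: small_incr_sum => j.
exact: (h i j).1.
Qed.

Lemma mprim_unif k l (X G : K -> 'M[K]_(k, l)) : mprim a b X G ->
  forall e, 0 < e -> exists2 d, 0 < d &
  forall u v, a <= u <= b -> a <= v <= b -> `|u - v| < d -> mxn (X v - X u) < e.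
Proof.
move=> /mprim_incr/small_incr_unif h e /h[d d0 dP]; exists d => // u v uab vab uv.
have [uv'|vu'] := leP u v.
  by apply: dP; move: uv; rewrite ltr_norml; lra.
by rewrite -mxnN opprB; apply: dP; move: uv; rewrite ltr_norml; lra.
Qed.

Lemma mxn_inv_sub n (A B : 'M[K]_n) : A \in unitmx -> B \in unitmx ->
  invmx A - invmx B = - (invmx A *m (A - B) *m invmx B).
Proof.
move=> uA uB; rewrite mulmxBr mulVmx// mulmxBl mul1mx.
by rewrite -mulmxA mulmxV// mulmx1 opprB.
Qed.

(** In A^-1 = B^-1 - A^-1 (A - B) B^-1 the last term is at most half of the norm of A^-1 and is
    absorbed on the left. *)
Lemma mxn_inv_near n (A B : 'M[K]_n) : A \in unitmx -> B \in unitmx ->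
  mxn (A - B) * mxn (invmx B) <= 1/2 -> mxn (invmx A) <= 2 * mxn (invmx B).
Proof.
move=> uA uB h.
have := mxnD (invmx B) (invmx A - invmx B).
rewrite addrC subrK mxn_inv_sub// mxnN => h1.
have h2 := mxnM (invmx A *m (A - B)) (invmx B).
have h3 := mxnM (invmx A) (A - B).
have h4 := mxn_ge0 (invmx A); have h5 := mxn_ge0 (invmx B).
have h6 : mxn (invmx A *m (A - B)) * mxn (invmx B) <=
  mxn (invmx A) * (mxn (A - B) * mxn (invmx B)).
  by rewrite mulrA ler_wpM2r.
have h7 : mxn (invmx A) * (mxn (A - B) * mxn (invmx B)) <= mxn (invmx A) * (1/2).
  by rewrite ler_wpM2l.
lra.
Qed.

(** Near each [x] the inverse is at most twice its size at [x]; real induction makes the bound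
    uniform on [a, b]. *)
Lemma inv_bounded n (X G : K -> 'M[K]_n) : mprim a b X G ->
  (forall s, a <= s <= b -> X s \in unitmx) ->
  exists2 C, 0 <= C & forall s, a <= s <= b -> mxn (invmx (X s)) <= C.
Proof.
move=> h u.
have [ba|ab] := ltP b a.
  by exists 0 => // s /andP[as_ sb]; move: (le_trans as_ sb); rewrite leNgt ba.
apply: (@real_induction K a b (fun x => exists2 C, 0 <= C &
  forall s, a <= s <= x -> mxn (invmx (X s)) <= C)) => //.
  exists (mxn (invmx (X a))); first exact: mxn_ge0.
  by move=> s; rewrite -eq_le => /eqP ->.
move=> x xab; set w := mxn (invmx (X x)).
have w0 : 0 <= w by exact: mxn_ge0.
(* Chosen so that its product with [w] is at most 1/2; adding 1 covers w = 0. *)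
have e0 : 0 < (2 * (w + 1))^-1 by rewrite invr_gt0; lra.
have [r r0 rP] := mprim_unif h e0; exists r => //.
move=> y z ay yx xz zb xy zx [C C0 HC]; exists (C + 2 * w); first lra.
move=> s /andP[as_ sz].
have [sy|ys] := leP s y.
  by have := HC s; rewrite as_ sy => /(_ isT); lra.
have sab : a <= s <= b by lra.
suff : mxn (invmx (X s)) <= 2 * w by lra.
apply: mxn_inv_near; [exact: u|exact: u|].
have := rP x s xab sab; rewrite ltr_norml => /(_ ltac:(lra)).
rewrite -/w => /ltW k.
apply: (@le_trans _ _ ((2 * (w + 1))^-1 * w)); first by rewrite ler_wpM2r.
rewrite mulrC ler_pdivrMr; lra.
Qed.

Lemma cvg_sumR (T : Type) (F : set_system T) (FF : Filter F) (I : Type) (r : seq I)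
   (f : I -> T -> K) (l : I -> K) : (forall i, f i x @[x --> F] --> l i) ->
  \sum_(i <- r) f i x @[x --> F] --> \sum_(i <- r) l i.
Proof.
move=> h; elim: r => [|i r IH].
  by under eq_fun do rewrite big_nil; rewrite big_nil; exact: cvg_cst.
by under eq_fun do rewrite big_cons; rewrite big_cons; exact: cvgD.
Qed.

Lemma is_deriveE (f : K -> K) (x g : K) :
  is_derive x (1 : K) f g <-> (h^-1 * (f (h + x) - f x)) @[h --> 0^'] --> g.
Proof.
have E : (fun h : K => h^-1 *: (f (h *: 1 + x) - f x)) =
         (fun h : K => h^-1 * (f (h + x) - f x)).
  by apply/funext => h; rewrite /GRing.scale/= mulr1.
split.
  move=> [df fg]; move: df; rewrite /derivable E => /cvg_ex[l lf].
  by rewrite -fg /derive E; have -> := cvg_lim _ lf.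
move=> h; split; first by rewrite /derivable E; apply/cvg_ex; exists g.
by rewrite /derive E; apply/cvg_lim.
Qed.

(** Increments of X^-1 are at most C^2 times those of X, where C bounds X^-1; this gives absolute
    continuity. The difference quotient of X^-1 at [s] is minus X(x + s)^-1 times the quotient of X
    times X(s)^-1, and converges wherever X is differentiable, X^-1 being continuous. *)
Lemma mprim_inv n (X G : K -> 'M[K]_n) : mprim a b X G ->
  (forall s, a <= s <= b -> X s \in unitmx) ->
  mprim a b (fun s => invmx (X s)) (fun s => - (invmx (X s) *m G s *m invmx (X s))).
Proof.
move=> h u; have [C C0 HC] := inv_bounded h u.
have incr (s t : K) : a <= s <= b -> a <= t <= b ->
    mxn (invmx (X t) - invmx (X s)) <= C * C * mxn (X t - X s).
  move=> sab tab; rewrite mxn_inv_sub; [|exact: u|exact: u]; rewrite mxnN.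
  apply: le_trans (mxnM _ _) _.
  apply: (@le_trans _ _ (mxn (invmx (X t)) * mxn (X t - X s) * mxn (invmx (X s)))).
    by rewrite ler_wpM2r ?mxn_ge0// mxnM.
  rewrite mulrAC; apply: ler_wpM2r; first exact: mxn_ge0.
  by apply: ler_pM; rewrite ?mxn_ge0// HC.
have all_ae : {ae mu, forall s, a < s < b -> forall i j,
    is_derive s 1 (fun s => X s i j) (G s i j)}.
  have : {ae mu, forall s, forall ij : 'I_n * 'I_n, a < s < b ->
      is_derive s 1 (fun s => X s ij.1 ij.2) (G s ij.1 ij.2)}.
    by apply: ae_forall => -[i j]; exact: (h i j).2.
  by apply: ae_imp => s H sab i j; exact: (H (i, j) sab).
move=> i j; split.
  apply: small_incr_le (small_incrZ _ (mprim_incr h)).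
    move=> s t as_ st tb; apply: le_trans (incr s t _ _); [|lra|lra].
    by have := le_mxn (invmx (X t) - invmx (X s)) i j; rewrite !mxE.
  exact: mulr_ge0.
apply: ae_imp all_ae => s H sab; apply/is_deriveE.
have sab' : a <= s <= b by lra.
have Wc k l : (invmx (X (x + s)) k l) @[x --> 0^'] --> invmx (X s) k l.
  apply/cvgrPdist_lt => e e0.
  have C1 : 0 < C * C + 1 by nra.
  have [r r0 rP] := mprim_unif h (divr_gt0 e0 C1).
  near=> x.
  have xr : `|x| < Num.min r (Num.min (s - a) (b - s)).
    near: x; apply: dnbhs0_lt; rewrite !lt_min r0 !subr_gt0; lra.
  move: xr; rewrite !lt_min => /and3P[xr xa xb].
  have xsab : a <= x + s <= b by move: xa xb; rewrite !ltr_norml; lra.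
  have := rP (x + s) s xsab sab'; rewrite addrK => /(_ xr).
  rewrite ltr_pdivlMr// => k1.
  have k2 := incr (x + s) s xsab sab'.
  have := le_mxn (invmx (X s) - invmx (X (x + s))) k l; rewrite !mxE.
  have := mxn_ge0 (X s - X (x + s)); nra.
apply: (@cvg_trans _ ((\sum_k (\sum_l - invmx (X (x + s)) i l *
    (x^-1 * (X (x + s) l k - X s l k))) * invmx (X s) k j) @[x --> 0^'])).
  apply: near_eq_cvg; near=> x.
  have xr : `|x| < Num.min (s - a) (b - s).
    near: x; apply: dnbhs0_lt; rewrite !lt_min !subr_gt0; lra.
  move: xr; rewrite !lt_min => /andP[xa xb].
  have xsab : a <= x + s <= b by move: xa xb; rewrite !ltr_norml; lra.
  have := mxn_inv_sub (u _ xsab) (u _ sab') => /matrixP/(_ i j).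
  rewrite !mxE => ->; rewrite -sumrN mulr_sumr; apply: eq_bigr => k _.
  rewrite mxE -mulNr -sumrN mulrA mulr_sumr; congr (_ * _).
  by apply: eq_bigr => l _; rewrite !mxE; ring.
rewrite !mxE -sumrN; apply: cvg_sumR => k.
rewrite -mulNr; apply: cvgM; last exact: cvg_cst.
rewrite mxE -sumrN; apply: cvg_sumR => l.
rewrite -mulNr; apply: cvgM; first by apply: cvgN; exact: Wc.
exact: (iffLR (is_deriveE _ _ _) (H sab l k)).
Unshelve. all: by end_near. Qed.

End mprim_inverse.

(** * Linear equations with integrable coefficients *)

Definition integrable_mx (K : realType) (k l : nat) (M : K -> 'M[K]_(k, l)) :=
  forall i j, (@lebesgue_measure K).-integrable setT (EFin \o (fun s => M s i j)).

(** * Picard iteration from the left end point *)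

Section picard.
Variables (K : realType) (N p : nat) (a : K) (M : K -> 'M[K]_N) (Z0 : 'M[K]_(N, p)).
Notation mu := (@lebesgue_measure K).
Hypothesis Mi : integrable_mx M.
Hypothesis M0 : forall s, s <= a -> M s = 0.

(** A class of functions kept by the Picard operator, and on which M Z is integrable. *)
Let bounded_mx (Z : K -> 'M[K]_(N, p)) :=
  (exists C, forall s i j, `|Z s i j| <= C) /\
  forall i j, measurable_fun setT (fun s => Z s i j).

Let step (Z : K -> 'M[K]_(N, p)) (x : K) : 'M[K]_(N, p) :=
  \matrix_(i, j) (Z0 i j + primitive (fun s => (M s *m Z s) i j) x).

Let integrable_MZ Z i j : bounded_mx Z ->
  mu.-integrable setT (EFin \o (fun s => (M s *m Z s) i j)).
Proof.
move=> [[C ZC] mZ]; under eq_fun do rewrite mxE.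
by apply: integrable_sumR => h; apply: (@integrableM_bounded _ _ _ C).
Qed.

Let bounded_step Z : bounded_mx Z -> bounded_mx (step Z).
Proof.
move=> bZ; split.
  pose c ij := `|Z0 ij.1 ij.2| + (\int[mu]_(t in setT) `|(M t *m Z t) ij.1 ij.2|)%R.
  exists (\sum_ij c ij) => s i j; rewrite mxE (bigD1 (i, j))//=.
  apply: le_trans (ler_normD _ _) _; rewrite -[leLHS]addr0; apply: lerD.
    by rewrite /c lerD2l; apply: primitive_bounded; exact: integrable_MZ.
  by apply: sumr_ge0 => ij _; rewrite addr_ge0//; apply: Rintegral_ge0.
move=> i j; under eq_fun do rewrite mxE.
apply: measurable_funD; first exact: measurable_cst.
apply: continuous_measurable_fun; apply: primitive_continuous.
exact: integrable_MZ.
Qed.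

Let step_prim Z c d : bounded_mx Z -> mprim c d (step Z) (fun s => M s *m Z s).
Proof.
move=> bZ i j; under eq_fun do rewrite mxE.
have := primD (prim_cst c d (Z0 i j)) (@prim_primitive _ _ c d (integrable_MZ i j bZ)).
by apply: prim_eq => s _; rewrite add0r.
Qed.

Let step_le Z x : x <= a -> step Z x = Z0.
Proof.
move=> xa; apply/matrixP => i j; rewrite mxE (primitive_eq0 (a := a)) ?addr0//.
by move=> s sa; rewrite M0// mul0mx mxE.
Qed.

Let z k := iter k step (fun=> 0).
Let E k s := z k.+1 s - z k s.

Let bz k : bounded_mx (z k).
Proof.
elim: k => [|k IH]; last exact: bounded_step.
split; first by exists 0 => s i j; rewrite mxE normr0.
by move=> i j; under eq_fun do rewrite mxE; exact: measurable_cst.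
Qed.

Let nu s := mxn (M s).
Let m := primitive nu.

Let nu_int : mu.-integrable setT (EFin \o nu).
Proof.
rewrite /nu/mxn; apply: integrable_sumR => i; apply: integrable_sumR => j.
exact: integrable_abse (Mi i j).
Qed.

Let m_ge0 x : 0 <= m x.
Proof. by apply: Rintegral_ge0 => s _; exact: mxn_ge0. Qed.

Let m_a : m a = 0.
Proof.
apply: (primitive_eq0 (a := a)) => // s sa; rewrite /nu M0// /mxn.
by apply: big1 => i _; apply: big1 => j _; rewrite mxE normr0.
Qed.

(** With [m] the primitive of the norm of M, the functions m^k / k! are primitives of one another
    times that norm: they reproduce the Picard recursion and will dominate the increments of the
    iterates. *)
Let prim_pow k c d : prim c d (fun x => exp_coeff (m x) k.+1)
  (fun x => exp_coeff (m x) k * nu x).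
Proof.
have mX n : prim c d (fun x => m x ^+ n.+1) (fun x => n.+1%:R * m x ^+ n * nu x).
  have m1 := @prim_primitive _ _ c d nu_int.
  elim: n => [|n IH]; first by apply: prim_eq m1 => s _; rewrite expr0 !mul1r.
  under eq_fun do rewrite exprS.
  apply: prim_eq (primM m1 IH) => s _.
  by rewrite -/m -(natr1 n.+1) exprS; ring.
have fS : k.+1`!%:R = k.+1%:R * k`!%:R :> K by rewrite factS natrM.
have f0 : k`!%:R != 0 :> K by rewrite pnatr_eq0 -lt0n fact_gt0.
have k0 : k.+1%:R != 0 :> K by rewrite pnatr_eq0.
have := primZ (k.+1`!%:R^-1) (mX k).
rewrite /exp_coeff/=; under eq_fun do rewrite mulrC.
apply: prim_eq => s _; rewrite fS; move: (k.+1%:R : K) (k`!%:R : K) k0 f0 => u v u0 v0.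
field; by rewrite ?u0 ?v0.
Qed.

(** The Picard estimate by m(x)^k / k!. To the right of [a], the bound plus or minus the entry of
    [E k.+1] vanishes at [a] and has a nonnegative derivative, so monotonicity replaces integration
    of the inequality. To the left of [a] all iterates from the first on equal [Z0]. *)
Let Ebound k x i j : `|E k x i j| <= mxn Z0 * exp_coeff (m x) k.
Proof.
elim: k x i j => [|k IH] x i j.
  rewrite /exp_coeff/= expr0 fact0 divr1 mulr1 /E /z/= subr0 mxE.
  rewrite (_ : (fun s => _) = fun=> 0); last first.
    by apply/funext => s; rewrite mulmx0 mxE.
  by rewrite /primitive Rintegral_cst// mul0r addr0 le_mxn.
have ES s : E k.+1 s = step (z k.+1) s - step (z k) s by [].
have [xa|ax] := leP x a.
  rewrite ES !step_le// subrr mxE normr0.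
  by rewrite mulr_ge0 ?mxn_ge0// /exp_coeff/= divr_ge0// exprn_ge0.
have pE : prim a x (fun s => E k.+1 s i j) (fun s => (M s *m E k s) i j).
  apply: prim_eq (mprimB (step_prim a x (bz k.+1)) (step_prim a x (bz k)) i j).
  by move=> s _; rewrite /E mulmxBr.
have Ea : E k.+1 a i j = 0.
  by rewrite ES !step_le// subrr mxE.
have ph := primZ (mxn Z0) (prim_pow k a x).
have ha : exp_coeff (m a) k.+1 = 0 by rewrite m_a /exp_coeff/= expr0n mul0r.
have MEb s : `|(M s *m E k s) i j| <= mxn Z0 * (exp_coeff (m s) k * nu s).
  rewrite mxE; apply: le_trans (ler_norm_sum _ _ _) _.
  apply: (@le_trans _ _ (\sum_h `|M s i h| * (mxn Z0 * exp_coeff (m s) k))).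
    by apply: ler_sum => h _; rewrite normrM ler_wpM2l.
  rewrite -mulr_suml mulrA [leRHS]mulrC ler_wpM2r//.
    by rewrite mulr_ge0 ?mxn_ge0// /exp_coeff/= divr_ge0// exprn_ge0.
  exact: row_le_mxn.
have ax' := ltW ax.
have b1 : {ae mu, forall s, a < s < x ->
    0 <= mxn Z0 * (exp_coeff (m s) k * nu s) + (M s *m E k s) i j}.
  by apply: aeW => s _; have := MEb s; rewrite ler_norml => /andP[]; lra.
have b2 : {ae mu, forall s, a < s < x ->
    0 <= mxn Z0 * (exp_coeff (m s) k * nu s) - (M s *m E k s) i j}.
  by apply: aeW => s _; have := MEb s; rewrite ler_norml => /andP[]; lra.
have h1 := prim_nondecreasing (primD ph pE) b1 (lexx a) ax' (lexx x).
have h2 := prim_nondecreasing (primB ph pE) b2 (lexx a) ax' (lexx x).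
move: h1 h2; rewrite ha (mulr0 (mxn Z0)) Ea.
move: (E k.+1 x i j) (mxn Z0 * exp_coeff (m x) k.+1) => u v.
rewrite addr0 subr0 => h1 h2; rewrite ler_norml -subr_ge0 opprK addrC h1.
by rewrite -subr_ge0.
Qed.

Let L := (\int[mu]_(t in setT) `|nu t|)%R.

(** The total integral L of the norm bounds [m] everywhere, so the iterates are dominated by an
    exponential series independent of [x]. *)
Let Ebound' k x i j : `|E k x i j| <= mxn Z0 * exp_coeff L k.
Proof.
apply: le_trans (Ebound k x i j) _; apply: ler_wpM2l; first exact: mxn_ge0.
rewrite /exp_coeff/=; apply: ler_wpM2r; first by rewrite invr_ge0.
apply: lerXn2r; rewrite ?nnegrE//; first exact: Rintegral_ge0.
by have := primitive_bounded x nu_int; rewrite ger0_norm.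
Qed.

Let series_cvg : cvgn (series (fun k => mxn Z0 * exp_coeff L k)).
Proof.
rewrite (_ : series _ = fun n => mxn Z0 * series (exp_coeff L) n); last first.
  by apply/funext => n; rewrite /series/= mulr_sumr.
by apply: is_cvgMr; exact: is_cvg_series_exp_coeff.
Qed.

Let zE i j x n : z n x i j = series (fun k => E k x i j) n.
Proof.
elim: n => [|n IH]; first by rewrite /series/= big_geq// mxE.
by rewrite /series/= big_nat_recr//= -[X in X + _]IH /E !mxE addrC subrK.
Qed.

Let z_cvg i j x : cvgn (fun n => z n x i j).
Proof.
rewrite (_ : (fun n => _) = series (fun k => E k x i j)); last first.
  by apply/funext => n; exact: zE.
apply: normed_cvg; apply: series_le_cvg series_cvg => n; [exact: normr_ge0| |exact: Ebound'].
by rewrite mulr_ge0 ?mxn_ge0// /exp_coeff/= divr_ge0// exprn_ge0// Rintegral_ge0.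
Qed.

Let B := limn (series (fun k => mxn Z0 * exp_coeff L k)).

Let z_bound n x i j : `|z n x i j| <= B.
Proof.
rewrite zE /series/=; apply: le_trans (ler_norm_sum _ _ _) _.
apply: (@le_trans _ _ (series (fun k => mxn Z0 * exp_coeff L k) n)).
  by rewrite /series/=; apply: ler_sum => k _; exact: Ebound'.
apply: nondecreasing_cvgn_le; last exact: series_cvg.
apply: nondecreasing_series => k _ _.
by rewrite mulr_ge0 ?mxn_ge0// /exp_coeff/= divr_ge0// exprn_ge0// Rintegral_ge0.
Qed.

Let w x : 'M[K]_(N, p) := \matrix_(i, j) limn (fun n => z n x i j).

Let zw x i j : (fun n => z n x i j) @ \oo --> w x i j.
Proof. by rewrite mxE; exact: z_cvg. Qed.

Let bw : bounded_mx w.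
Proof.
split; last first.
  move=> i j; apply: (@measurable_fun_cvg _ _ _ _ (fun n x => z n x i j)).
    by move=> n; exact: (bz n).2.
  by move=> x _; exact: zw.
exists B => x i j; rewrite ler_norml mxE; apply/andP; split.
  by apply: limr_ge; [exact: z_cvg|apply: nearW => n; have := z_bound n x i j;
    rewrite ler_norml => /andP[]].
by apply: limr_le; [exact: z_cvg|apply: nearW => n; have := z_bound n x i j;
    rewrite ler_norml => /andP[]].
Qed.

(** Dominated convergence: all iterates are bounded by B, hence the integrands by B times the norm
    of M. *)
Let step_cvg x i j : (fun n => z n.+1 x i j) @ \oo --> step w x i j.
Proof.
rewrite (_ : (fun n => _) = fun n => Z0 i j + primitive (fun s => (M s *m z n s) i j) x);
  last by apply/funext => n; rewrite /z iterS mxE.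
rewrite mxE; apply: cvgD; first exact: cvg_cst.
have int Z : bounded_mx Z ->
    mu.-integrable `]-oo, x] (EFin \o (fun s => (M s *m Z s) i j)).
  by move=> bZ; apply: integrableS (integrable_MZ i j bZ).
apply: fine_cvg; rewrite fineK; last by apply: integrable_fin_num => //; exact: int.
apply: (@dominated_cvg _ _ _ mu _ _ _ _ (fun s => (B * nu s)%:E)) => //.
- by move=> n; case/integrableP: (int _ (bz n)).
- move=> s _; apply/cvg_EFin; first by apply: nearW.
  rewrite /comp/= mxE; under eq_fun do rewrite mxE.
  by apply: cvg_sumR => h; apply: cvgM; [exact: cvg_cst|exact: zw].
- have nui : mu.-integrable `]-oo, x] (EFin \o nu) by apply: integrableS nu_int.
  exact: (integrableZl _ B nui).
move=> n s _; rewrite /= lee_fin mxE; apply: le_trans (ler_norm_sum _ _ _) _.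
apply: (@le_trans _ _ (\sum_h `|M s i h| * B)).
  by apply: ler_sum => h _; rewrite normrM ler_wpM2l// z_bound.
rewrite -mulr_suml mulrC ler_wpM2l//.
  by apply: le_trans (z_bound 0 0 i j).
exact: row_le_mxn.
Qed.

(** The limit of the iterates is a fixed point of the Picard operator, whose values are primitives
    on every interval. *)
Lemma linear_ode_exists : exists Z : K -> 'M[K]_(N, p), Z a = Z0 /\
  forall c d, mprim c d Z (fun s => M s *m Z s).
Proof.
have wE : step w = w.
  apply/funext => x; apply/matrixP => i j.
  have c1 := @step_cvg x i j; have := @zw x i j.
  rewrite -(@cvg_shiftS _ (fun n => z n x i j)) => c2.
  by apply: cvg_unique c1 c2; exact: Rhausdorff.
exists w; split; first by rewrite -wE step_le.
by move=> c d; rewrite -[X in mprim c d X]wE; exact: step_prim.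
Qed.

End picard.

Section integrable_mx_theory.
Variable K : realType.

Lemma integrable_mxZ k l c (M : K -> 'M[K]_(k, l)) : integrable_mx M ->
  integrable_mx (fun s => c *: M s).
Proof.
move=> Mi i j; under eq_fun do rewrite mxE.
exact: (integrableZl measurableT c (Mi i j)).
Qed.

Lemma integrable_mxN k l (M : K -> 'M[K]_(k, l)) : integrable_mx M ->
  integrable_mx (fun s => - M s).
Proof. by move=> /(integrable_mxZ (-1)) Mi; under eq_fun do rewrite -scaleN1r. Qed.

Lemma integrable_mxB k l (M N : K -> 'M[K]_(k, l)) : integrable_mx M ->
  integrable_mx N -> integrable_mx (fun s => M s - N s).
Proof.
move=> Mi Ni i j; under eq_fun do rewrite !mxE.
exact: (integrableB measurableT (Mi i j) (Ni i j)).
Qed.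

Lemma integrable_mx_tr k l (M : K -> 'M[K]_(k, l)) : integrable_mx M ->
  integrable_mx (fun s => (M s)^T).
Proof. by move=> Mi i j; under eq_fun do rewrite mxE; exact: Mi. Qed.

Lemma integrable_mx_block n (M1 M2 M3 M4 : K -> 'M[K]_n) :
  integrable_mx M1 -> integrable_mx M2 -> integrable_mx M3 -> integrable_mx M4 ->
  integrable_mx (fun s => block_mx (M1 s) (M2 s) (M3 s) (M4 s)).
Proof.
move=> h1 h2 h3 h4 i j.
case: (split_ordP i) => i' ->; case: (split_ordP j) => j' ->;
  [under eq_fun do rewrite block_mxEul | under eq_fun do rewrite block_mxEur
  |under eq_fun do rewrite block_mxEdl | under eq_fun do rewrite block_mxEdr];
  by [].
Qed.

End integrable_mx_theory.

(** * Fundamental matrices and the Hamiltonian system *)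

Section linear_flow.
Variables (K : realType) (a b : K).

(** Both solutions start from the identity at [a] and (G F)' = 0, so G is the inverse of F. For any
    solution of Z' = M Z the product G Z is constant, which is how uniqueness is used later. *)
Lemma adjoint_flow N (M : K -> 'M[K]_N) : integrable_mx M ->
  (forall s, s <= a -> M s = 0) ->
  exists F G : K -> 'M[K]_N, [/\ mprim a b F (fun s => M s *m F s),
    mprim a b G (fun s => - (G s *m M s)) &
    forall s, a <= s <= b -> G s *m F s = 1%:M].
Proof.
move=> Mi M0.
have [F [Fa pF]] := linear_ode_exists 1%:M Mi M0.
have Mi' : integrable_mx (fun s => - (M s)^T).
  exact/integrable_mxN/integrable_mx_tr.
have M0' s : s <= a -> - (M s)^T = 0 by move=> /M0 ->; rewrite trmx0 oppr0.
have [G [Ga pG]] := linear_ode_exists 1%:M Mi' M0'.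
have pG' : mprim a b (fun s => (G s)^T) (fun s => - ((G s)^T *m M s)).
  by apply: mprim_eq (mprim_tr (pG a b)) => s _; rewrite trmx_mul linearN/= trmxK mulmxN.
exists F, (fun s => (G s)^T); split => //.
move=> s /andP[as_ sb].
have ae0 : {ae (@lebesgue_measure K), forall x, a < x < b ->
    - ((G x)^T *m M x) *m F x + (G x)^T *m (M x *m F x) = 0}.
  by apply: aeW => x _; rewrite mulNmx mulmxA addNr.
have := mprim_const (mprimM pG' (pF a b)) ae0 (lexx a) as_ sb.
by rewrite Fa Ga mulmx1 trmx1 => <-.
Qed.

(** Picard iteration starts at [a], while the data may be given at the right end; the inverse flow
    transports them. *)
Lemma linear_ode_at N p (M : K -> 'M[K]_N) (s0 : K) (Z0 : 'M[K]_(N, p)) :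
  integrable_mx M -> (forall s, s <= a -> M s = 0) -> a <= s0 <= b ->
  exists Z : K -> 'M[K]_(N, p), Z s0 = Z0 /\ mprim a b Z (fun s => M s *m Z s).
Proof.
move=> Mi M0 s0ab; have [F [G [pF pG GF]]] := adjoint_flow Mi M0.
exists (fun s => F s *m (G s0 *m Z0)); split.
  by rewrite mulmxA (mulmx1C (GF _ s0ab)) mul1mx.
apply: mprim_eq (mprimM pF (mprim_cst a b (G s0 *m Z0))) => s _.
by rewrite /= mulmx0 addr0 !mulmxA.
Qed.

Lemma hamiltonian_flow n (A Q S : K -> 'M[K]_n) (sg s0 : K) :
  integrable_mx A -> integrable_mx Q -> integrable_mx S ->
  (forall s, s <= a -> A s = 0) -> (forall s, s <= a -> Q s = 0) ->
  (forall s, s <= a -> S s = 0) -> a <= s0 <= b ->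
  exists X Y : K -> 'M[K]_n, [/\ X s0 = 1%:M, Y s0 = 0,
    mprim a b X (fun s => - (A s)^T *m X s + sg *: (Q s *m Y s)) &
    mprim a b Y (fun s => A s *m Y s + sg *: (S s *m X s))].
Proof.
move=> Ai Qi Si A0 Q0 S0 s0ab.
pose H s := block_mx (- (A s)^T) (sg *: Q s) (sg *: S s) (A s).
have Hi : integrable_mx H.
  apply: integrable_mx_block => //; [|exact: integrable_mxZ|exact: integrable_mxZ].
  exact/integrable_mxN/integrable_mx_tr.
have H0 s : s <= a -> H s = 0.
  move=> sa; rewrite /H A0// Q0// S0// trmx0 oppr0 !scaler0.
  exact: block_mx0.
have [Z [Zs0 pZ]] := linear_ode_at (col_mx 1%:M 0 : 'M[K]_(n + n, n)) Hi H0 s0ab.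
exists (fun s => usubmx (Z s)), (fun s => dsubmx (Z s)); split.
- by rewrite Zs0 col_mxKu.
- by rewrite Zs0 col_mxKd.
- move=> i j; under eq_fun do rewrite mxE.
  apply: prim_eq (pZ (lshift n i) j) => s _ /=; rewrite /H -{1}[Z s]vsubmxK.
  by rewrite mul_block_col col_mxEu -scalemxAl.
- move=> i j; under eq_fun do rewrite mxE.
  apply: prim_eq (pZ (rshift n i) j) => s _ /=; rewrite /H -{1}[Z s]vsubmxK.
  by rewrite mul_block_col col_mxEd -scalemxAl addrC.
Qed.

End linear_flow.

(** * Quadratic forms and eigenvalues *)

Section quadratic_forms.
Variables (K : realType) (n : nat).
Implicit Types (M P : 'M[K]_n) (v w : 'cV[K]_n).

Lemma quad_formE M v : quad_form M v = \sum_i \sum_j v i ord0 * M i j * v j ord0.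
Proof.
rewrite /quad_form mxE exchange_big/=; apply: eq_bigr => j _.
by rewrite mxE mulr_suml; apply: eq_bigr => i _; rewrite mxE.
Qed.

Lemma quad_form_scalar c v : quad_form c%:M v = c * \sum_i v i ord0 ^+ 2.
Proof.
rewrite /quad_form mul_mx_scalar -scalemxAl !mxE; congr (_ * _).
by apply: eq_bigr => i _; rewrite mxE expr2.
Qed.

Lemma quad_formB M P v : quad_form (M - P) v = quad_form M v - quad_form P v.
Proof. by rewrite /quad_form mulmxBr mulmxBl mxE [in X in _ + X]mxE. Qed.

Lemma quad_form0 v : quad_form 0 v = 0.
Proof. by rewrite /quad_form mulmx0 mul0mx mxE. Qed.

Lemma quad_formZ c M v : quad_form M (c *: v) = c ^+ 2 * quad_form M v.
Proof.
rewrite /quad_form [(c *: v)^T]linearZ/= -!scalemxAl -scalemxAr scalerA -expr2.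
by rewrite [LHS]mxE.
Qed.

Lemma sum_sqr_gt0 v : v != 0 -> 0 < \sum_i v i ord0 ^+ 2.
Proof.
move=> v0; rewrite lt_neqAle sumr_ge0 ?andbT; last by move=> *; exact: sqr_ge0.
apply: contra v0 => /eqP/esym/psumr_eq0P h; apply/eqP/colP => i.
by apply/eqP; rewrite mxE -sqrf_eq0 h// => j _; exact: sqr_ge0.
Qed.

(** For w = M v, the polynomial e -> (v + e w)^T M (v + e w) is nonnegative and vanishes at 0, so
    its slope there, 2 w^T w, must be zero. *)
Lemma psd_ker M v : M^T = M -> psd_le 0 M -> quad_form M v = 0 -> M *m v = 0.
Proof.
move=> Ms M0 Mv0; set w := M *m v.
have key e : 0 <= 2 * e * quad_form 1%:M w + e ^+ 2 * quad_form M w.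
  have := M0 (v + e *: w); rewrite quad_form0; congr (_ <= _).
  rewrite -[RHS]add0r -Mv0 /quad_form mulmx1.
  have E : v^T *m M = w^T by rewrite /w trmx_mul Ms.
  rewrite [(v + _)^T]linearD/= [(e *: w)^T]linearZ/= !mulmxDl !mulmxDr -!scalemxAl E -!scalemxAr.
  rewrite -[w^T *m M *m v]mulmxA -/w.
  by move: (w^T *m v) (w^T *m w) (w^T *m M *m w) => x y z; rewrite !mxE; ring.
have W0 : 0 <= quad_form 1%:M w.
  by rewrite quad_form_scalar mul1r sumr_ge0// => i _; exact: sqr_ge0.
apply/eqP; apply/negPn/negP => /sum_sqr_gt0 wpos.
have W1 : 0 < quad_form 1%:M w by rewrite quad_form_scalar mul1r.
have M1 : 0 <= quad_form M w by have := M0 w; rewrite quad_form0.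
(* At [- e] the polynomial equals e (e q - 2 w^T w) with q = w^T M w, and e q < w^T w makes it
   negative. Adding 1 to the denominator covers q = 0. *)
pose e := quad_form 1%:M w / (quad_form M w + 1).
have e0 : 0 < e by apply: divr_gt0 => //; lra.
have := key (- e); have eM : e * (quad_form M w + 1) = quad_form 1%:M w.
  by rewrite /e divfK// gt_eqF//; lra.
nra.
Qed.

Lemma unitmx_inj M : (forall v, M *m v = 0 -> v = 0) -> M \in unitmx.
Proof.
move=> h; rewrite -unitmx_tr -row_free_unit -kermx_eq0; apply/rowV0P => v.
move=> /sub_kermxP vM; have : M *m v^T = 0 by rewrite -[M]trmxK -trmx_mul vM trmx0.
by move=> /h /(congr1 trmx); rewrite trmxK trmx0.
Qed.

Lemma posdef_unit M : sym_posdef M -> M \in unitmx.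
Proof.
move=> [_ M0]; apply: unitmx_inj => v Mv; apply/eqP/negPn/negP => /M0.
by rewrite /quad_form -mulmxA Mv mulmx0 mxE ltxx.
Qed.

Lemma coercive_unit M d : 0 < d -> psd_le d%:M M -> M \in unitmx.
Proof.
move=> d0 dM; apply: unitmx_inj => v Mv; apply/eqP/negPn/negP => /sum_sqr_gt0 v0.
have := dM v; rewrite quad_form_scalar /quad_form -mulmxA Mv mulmx0 mxE.
by have := mulr_gt0 d0 v0; lra.
Qed.

(** The column w = M^-1 e_j satisfies d w^T w <= w^T M w = w_j. Hence d w_j^2 <= w_j, so w_j <= 1/d,
    and then d w_i^2 <= 1/d for every i. *)
Lemma coercive_inv_le M d i j : 0 < d -> psd_le d%:M M -> `|invmx M i j| <= d^-1.
Proof.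
move=> d0 dM; have uM := coercive_unit d0 dM.
pose w := col j (invmx M).
have Mw : M *m w = delta_mx j ord0 by rewrite /w colE mulmxA mulmxV// mul1mx.
have wE k : w k ord0 = invmx M k j by rewrite mxE.
have := dM w; rewrite quad_form_scalar /quad_form -mulmxA Mw -colE !mxE ?wE.
set S := \sum_i _ => dS.
have S0 k : invmx M k j ^+ 2 <= S.
  by rewrite /S (bigD1 k)//= wE lerDl sumr_ge0// => ? _; exact: sqr_ge0.
have dd : d * d^-1 = 1 by rewrite mulfV// gt_eqF.
have d1 : 0 < d^-1 by rewrite invr_gt0.
have b1 : invmx M j j <= d^-1.
  rewrite leNgt; apply/negP => lt.
  have := S0 j; have : d * invmx M j j > 1 by rewrite -dd ltr_pM2l.
  by nra.
have : d * invmx M i j ^+ 2 <= d^-1.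
  by apply: le_trans b1; apply: le_trans dS; rewrite ler_pM2l.
rewrite -(ler_pM2l d1) mulrA mulVf ?gt_eqF// mul1r -expr2.
rewrite -(real_normK (num_real (invmx M i j))) ler_pXn2r ?nnegrE//.
exact: ltW.
Qed.

Hypothesis n0 : (0 < n)%N.

(** The form attains its minimum l on the unit sphere. By homogeneity M - l is positive
    semidefinite, and it vanishes on the minimiser, which therefore lies in its kernel. *)
Lemma sym_min_eigen M : M^T = M -> exists (l : K) (v : 'cV[K]_n),
  [/\ v != 0, M *m v = l *: v & psd_le l%:M M].
Proof.
move=> Ms.
pose q (r : 'rV[K]_n) := quad_form M r^T.
pose N2 (r : 'rV[K]_n) := \sum_i r ord0 i ^+ 2.
have cq : continuous q.
  have -> : q = fun r => \sum_i \sum_j r ord0 i * M i j * r ord0 j.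
    apply/funext => r; rewrite /q quad_formE; apply: eq_bigr => i _.
    by apply: eq_bigr => j _; rewrite !mxE.
  move=> r; apply: (@cvg_sumR _ _ _ (nbhs_filter r)) => i.
  apply: (@cvg_sumR _ _ _ (nbhs_filter r)) => j.
  apply: cvgM; last exact: coord_continuous.
  by apply: cvgM; [exact: coord_continuous|exact: cvg_cst].
have cN : continuous N2.
  have -> : N2 = fun r => \sum_i r ord0 i * r ord0 i.
    by apply/funext => r; apply: eq_bigr => i _; rewrite expr2.
  move=> r; apply: (@cvg_sumR _ _ _ (nbhs_filter r)) => i.
  by apply: cvgM; exact: coord_continuous.
pose A := N2 @^-1` [set 1].
have compA : compact A.
  apply: bounded_closed_compact.
    exists 1; split => // x x1 r /= Ar; apply: le_trans (ltW x1).
    rewrite /Num.Def.normr/= mx_normrE; apply: bigmax_le => // -[i j] _ /=.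
    rewrite ord1 -(@ler_pXn2r _ 2)// ?nnegrE// expr1n real_normK ?num_real//.
    by rewrite -Ar /N2 (bigD1 j)//= lerDl sumr_ge0// => ? _; exact: sqr_ge0.
  apply: preimage_closed; first by move=> ? _; exact: cN.
  exact: closed_eq.
have A0 : A !=set0.
  exists (delta_mx ord0 (Ordinal n0)); rewrite /A /= /N2.
  rewrite (bigD1 (Ordinal n0))//= mxE !eqxx expr1n big1 ?addr0// => i /negPf ni.
  by rewrite mxE ni andbF expr0n.
have [r /set_mem rA rmin] := compact_EVT_min A0 compA (continuous_subspaceT cq).
have rN : N2 r = 1 by [].
have psd : psd_le (q r)%:M M.
  move=> v; rewrite quad_form_scalar.
  have [->|v0] := eqVneq v 0.
    rewrite /quad_form mulmx0 mxE big1 ?mulr0// => i _.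
    by rewrite mxE expr0n.
  set s := \sum_i _; have s0 : 0 < s by exact: sum_sqr_gt0.
  pose c := (Num.sqrt s)^-1.
  have c2 : c ^+ 2 = s^-1 by rewrite exprVn sqr_sqrtr// ltW.
  have /rmin : c *: v^T \in A.
    apply/mem_set; rewrite /A/= /N2.
    under eq_bigr do rewrite !mxE exprMn c2; rewrite -mulr_sumr -/s.
    by rewrite mulVf// gt_eqF.
  rewrite {2}/q [(c *: v^T)^T]linearZ/= trmxK quad_formZ c2 => h.
  have sv : 0 < s^-1 by rewrite invr_gt0.
  by rewrite -(ler_pM2l sv) mulrCA mulVf ?gt_eqF// mulr1.
exists (q r), r^T; split => //.
  apply/eqP => r0; have : r = 0 by rewrite -[r]trmxK r0 trmx0.
  move=> rr; move: rN; rewrite rr /N2 big1; last by move=> i _; rewrite mxE expr0n.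
  by move/eqP; rewrite eq_sym oner_eq0.
apply/eqP; rewrite -subr_eq0 -mul_scalar_mx -mulmxBl; apply/eqP; apply: psd_ker.
- by rewrite linearB/= Ms tr_scalar_mx.
- by move=> v; rewrite quad_form0 quad_formB subr_ge0.
- rewrite quad_formB quad_form_scalar -/(q r).
  have -> : \sum_i r^T i ord0 ^+ 2 = N2 r by apply: eq_bigr => i _; rewrite mxE.
  by rewrite rN mulr1 subrr.
Qed.

Lemma posdef_eigen_gt0 M l : sym_posdef M -> eigenvalue M l -> 0 < l.
Proof.
move=> [Ms M0] /eigenvalueP[v vM v0].
have v0' : v^T != 0 by rewrite -(inj_eq trmx_inj) trmxK trmx0.
have E : quad_form M v^T = l * \sum_i v^T i ord0 ^+ 2.
  rewrite /quad_form trmxK vM -scalemxAl mxE mxE; congr (_ * _).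
  by apply: eq_bigr => i _; rewrite !mxE expr2.
by have := M0 _ v0'; rewrite E pmulr_lgt0// sum_sqr_gt0.
Qed.

Lemma min_spectrum_psd M : sym_posdef M -> psd_le (min_spectrum M)%:M M.
Proof.
move=> MP v; have [l [w [w0 Mw lM]]] := sym_min_eigen MP.1.
apply: le_trans (lM v); rewrite !quad_form_scalar ler_wpM2r//.
  by apply: sumr_ge0 => i _; exact: sqr_ge0.
(* Positive definiteness bounds the spectrum below by 0, which is what makes the infimum a lower
   bound. *)
apply: ge_inf; first by exists 0 => x /= /(posdef_eigen_gt0 MP)/ltW.
apply/eigenvalueP; exists w^T; last by rewrite -(inj_eq trmx_inj) trmxK trmx0.
by rewrite -{1}MP.1 -trmx_mul Mw linearZ.
Qed.

(** Symmetry provides an eigenvalue, so the infimum is over a nonempty set and is not a default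
    value. *)
Lemma min_spectrum_ge M c : M^T = M ->
  (forall l, eigenvalue M l -> c <= l) -> c <= min_spectrum M.
Proof.
move=> Ms h; apply: lb_le_inf => //.
have [l [w [w0 Mw lM]]] := sym_min_eigen Ms; exists l.
apply/eigenvalueP; exists w^T; last by rewrite -(inj_eq trmx_inj) trmxK trmx0.
by rewrite -{1}Ms -trmx_mul Mw linearZ.
Qed.

End quadratic_forms.

(** * The Riccati equation *)

Section hamiltonian_algebra.
Variables (F : comNzRingType) (n : nat) (c : F).
Implicit Types A P Q S V W X Y : 'M[F]_n.

(** Only the additive structure is unfolded entrywise, so that entries of matrix products remain
    atoms for [ring]. *)
Let addE (M N : 'M[F]_n) i j : (M + N) i j = M i j + N i j. Proof. exact: mxE. Qed.
Let oppE (M : 'M[F]_n) i j : (- M) i j = - M i j. Proof. exact: mxE. Qed.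
Let scaleE a (M : 'M[F]_n) i j : (a *: M) i j = a * M i j. Proof. exact: mxE. Qed.

Let expand := (@mulmxDl F n n n, @mulmxDr F n n n, @mulmxN F n n n, @mulNmx F n n n).
Let scale (M N : 'M[F]_n) a : ((a *: M) *m N = a *: (M *m N) :> 'M[F]_n) *
  (M *m (a *: N) = a *: (M *m N) :> 'M[F]_n).
Proof. by rewrite -scalemxAl -scalemxAr. Qed.

(** The left side is the derivative of X^T Y along the Hamiltonian system; the terms in A cancel. *)
Lemma hamiltonian_energy A Q S X Y : Q^T = Q ->
  (- A^T *m X + c *: (Q *m Y))^T *m Y + X^T *m (A *m Y + c *: (S *m X)) =
  c *: (Y^T *m Q *m Y + X^T *m S *m X).
Proof.
move=> Qs; rewrite [(_ + _)^T]raddfD/= [(_ *: _)^T]linearZ/= !trmx_mul.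
rewrite [(- _)^T]raddfN/= trmxK Qs !(expand, scale) !mulmxA.
by apply/matrixP => i j; rewrite !(addE, oppE, scaleE); ring.
Qed.

(** The left side is the derivative of X Y^-1 given by the product rule, with V = Y^-1; the right
    side is that of the Riccati equation for P = X V. *)
Lemma hamiltonian_quotient A Q S X Y V : Y *m V = 1%:M ->
  (- A^T *m X + c *: (Q *m Y)) *m V +
    X *m (- (V *m (A *m Y + c *: (S *m X)) *m V)) =
  c *: Q - A^T *m (X *m V) - X *m V *m A - c *: (X *m V *m S *m (X *m V)).
Proof.
move=> YV; rewrite !(expand, scale) !mulmxA.
rewrite -[Q *m Y *m V]mulmxA -[_ *m A *m Y *m V]mulmxA YV !mulmx1.
by apply/matrixP => i j; rewrite !(addE, oppE, scaleE); ring.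
Qed.

(** The derivative of W = P^-1: a Riccati equation in which Q and S have exchanged their roles. *)
Lemma riccati_inverse A P Q S W : W *m P = 1%:M -> P *m W = 1%:M ->
  - (W *m (c *: Q - A^T *m P - P *m A - c *: (P *m S *m P)) *m W) =
  A *m W + W *m A^T - c *: (W *m Q *m W) + c *: S.
Proof.
move=> WP PW; rewrite !(expand, scale) !mulmxA WP !mul1mx.
rewrite -[_ *m A^T *m P *m W]mulmxA -[S *m P *m W]mulmxA PW !mulmx1.
by apply/matrixP => i j; rewrite !(addE, oppE, scaleE); ring.
Qed.

(** The derivative of Y - W X. The terms in S and in A^T cancel, and a factor Y - W X comes out of
    what remains. *)
Lemma riccati_defect A Q S W X Y :
  A *m Y + c *: (S *m X) -
    ((A *m W + W *m A^T - c *: (W *m Q *m W) + c *: S) *m X +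
     W *m (- A^T *m X + c *: (Q *m Y))) =
  (A - c *: (W *m Q)) *m (Y - W *m X).
Proof.
rewrite !(expand, scale) !mulmxA.
by apply/matrixP => i j; rewrite !(addE, oppE, scaleE); ring.
Qed.

End hamiltonian_algebra.

Section riccati.
Variables (K : realType) (n : nat) (a b : K) (fwd : bool).
Variables (A Q S : K -> 'M[K]_n).
Notation mu := (@lebesgue_measure K).

Let sg : K := if fwd then 1 else -1.
Let s0 : K := if fwd then a else b.

Definition away (s : K) : bool := (a <= s <= b) && (s != s0).

Definition riccati_rhs (s : K) (P : 'M[K]_n) : 'M[K]_n :=
  sg *: Q s - (A s)^T *m P - P *m A s - sg *: (P *m S s *m P).

(** Common form of both problems, s0 being [a] or [b] according to [fwd]. Absolute continuity is
    asked on compact intervals avoiding s0, and the blow-up is spelled out with a radius so that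
    both one-sided limits look alike. *)
Definition riccati_solution (P : K -> 'M[K]_n) : Prop :=
  [/\ forall s, away s -> sym_posdef (P s),
      forall c d, c <= d -> (forall s, c <= s <= d -> away s) ->
        mprim c d P (fun s => riccati_rhs s (P s)) &
      forall M, exists2 r, 0 < r &
        forall s, away s -> `|s - s0| < r -> M <= min_spectrum (P s)].

Hypotheses (n0 : (0 < n)%N) (ab : a < b).
Hypotheses (Ai : integrable_mx A) (Qi : integrable_mx Q) (Si : integrable_mx S).
Hypotheses (A0 : forall s, s <= a -> A s = 0) (Q0 : forall s, s <= a -> Q s = 0)
  (S0 : forall s, s <= a -> S s = 0).
Hypotheses (Qsym : {ae mu, forall s, a < s < b -> (Q s)^T = Q s})
  (Qpsd : {ae mu, forall s, a < s < b -> psd_le 0 (Q s)})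
  (Spsd : {ae mu, forall s, a < s < b -> psd_le 0 (S s)}).
(* The observability form of complete controllability. *)
Hypothesis obs : forall c d (p : K -> 'cV[K]_n), a <= c -> c < d -> d <= b ->
  mprim c d p (fun s => - (A s)^T *m p s) ->
  {ae mu, forall s, c < s < d -> quad_form (S s) (p s) = 0} ->
  p c = 0 /\ p d = 0.

Let s0ab : a <= s0 <= b.
Proof. by rewrite /s0; case: fwd; rewrite lexx ltW. Qed.

Let away_ab s : away s -> a <= s <= b. Proof. by case/andP. Qed.

Let away_itv c d : away c -> away d -> forall s, c <= s <= d -> away s.
Proof.
rewrite /away => /andP[/andP[ac cb] cs] /andP[/andP[ad db] ds] s /andP[cs' sd].
rewrite (le_trans ac cs') (le_trans sd db)/=; apply/eqP => e.
move: cs ds e; rewrite /s0; case: fwd => /eqP cs /eqP ds e.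
  by apply: cs; apply/le_anti; lra.
by apply: ds; apply/le_anti; lra.
Qed.

Let away_in s : a < s < b -> away s.
Proof.
move=> sab; rewrite /away; apply/andP; split; first lra.
by rewrite /s0; case: fwd; apply/eqP; lra.
Qed.

Let away_near r : 0 < r -> exists2 s, away s & `|s - s0| < r.
Proof.
move=> r0; pose h := Num.min r (b - a) / 2.
have m0 : 0 < Num.min r (b - a) by rewrite lt_min r0 subr_gt0.
have mr : Num.min r (b - a) <= r by rewrite ge_min lexx.
have mb : Num.min r (b - a) <= b - a by rewrite ge_min lexx orbT.
have : 0 < h < r by rewrite /h; lra.
have : h < b - a by rewrite /h; lra.
move=> hb h0; exists (if fwd then a + h else b - h).
  by apply: away_in; case: fwd; lra.
by rewrite /s0 ltr_norml; case: fwd; lra.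
Qed.

Let vanish_const k l (Z G : K -> 'M[K]_(k, l)) :
  (forall c d, c <= d -> (forall s, c <= s <= d -> away s) -> mprim c d Z G) ->
  {ae mu, forall s, a < s < b -> G s = 0} ->
  forall s t, away s -> away t -> Z s = Z t.
Proof.
move=> pZ G0.
suff H s t : away s -> away t -> s <= t -> Z s = Z t.
  move=> s t As At; have [st|ts] := leP s t; first exact: H.
  by apply/esym/H => //; exact: ltW.
move=> As At st; have := pZ s t st (away_itv As At) => h.
apply: (mprim_const h) => //.
apply: ae_imp G0 => x H /andP[sx xt]; apply: H.
by have := away_ab As; have := away_ab At; lra.
Qed.

(** * Existence: positivity of X^T Y and the quotient X Y^-1 *)

Section solution.
Variables X Y : K -> 'M[K]_n.
Hypotheses (X0 : X s0 = 1%:M) (Y0 : Y s0 = 0)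
  (pX : mprim a b X (fun s => - (A s)^T *m X s + sg *: (Q s *m Y s)))
  (pY : mprim a b Y (fun s => A s *m Y s + sg *: (S s *m X s))).
Hypothesis Ssym : {ae mu, forall s, a < s < b -> (S s)^T = S s}.

Let D s := (X s)^T *m Y s.

Let pD : mprim a b D
  (fun s => sg *: ((Y s)^T *m Q s *m Y s + (X s)^T *m S s *m X s)).
Proof.
apply: mprim_ae (mprimM (mprim_tr pX) pY); apply: ae_imp Qsym => s H /H {}H.
exact: hamiltonian_energy.
Qed.

Let D0 : D s0 = 0. Proof. by rewrite /D Y0 mulmx0. Qed.

(** D - D^T has zero derivative, since Q and S are symmetric almost everywhere, and vanishes at
    s0. *)
Let Dsym s : a <= s <= b -> (D s)^T = D s.
Proof.
move=> /andP[as_ sb].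
have p0 : {ae mu, forall s, a < s < b ->
    sg *: ((Y s)^T *m Q s *m Y s + (X s)^T *m S s *m X s) -
    (sg *: ((Y s)^T *m Q s *m Y s + (X s)^T *m S s *m X s))^T = 0}.
  apply: ae_imp2 Qsym Ssym => x hQ hS xab.
  rewrite [(_ *: _)^T]linearZ/= [(_ + _)^T]raddfD/= !trmx_mul !trmxK hQ// hS//.
  by rewrite !mulmxA subrr.
have pDD := mprimB pD (mprim_tr pD).
have e0 : D s0 - (D s0)^T = 0 by rewrite D0 trmx0 subrr.
apply/esym/eqP; rewrite -subr_eq0; apply/eqP.
rewrite -{}e0 /s0; case: fwd.
  by apply/esym; apply: (mprim_const pDD).
by apply: (mprim_const pDD).
Qed.

(** The factor [sg] makes this nondecreasing in both cases: it rises from 0 when s0 = a and rises to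
    0 when s0 = b. Either way c^T D c >= 0. *)
Let energy c s := sg * quad_form (D s) c.
Let power c s := quad_form (Q s) (Y s *m c) + quad_form (S s) (X s *m c).

Let sg2 : sg * sg = 1. Proof. by rewrite /sg; case: fwd; ring. Qed.

Let pE c : prim a b (energy c) (power c).
Proof.
have h := mprimM (mprimM (mprim_cst a b c^T) pD) (mprim_cst a b c).
have := primZ sg (h ord0 ord0); apply: prim_eq => s _.
rewrite mul0mx add0r mulmx0 addr0 -scalemxAr -scalemxAl mxE mulrA sg2 mul1r.
rewrite mulmxDr mulmxDl mxE /power /quad_form !trmx_mul.
by rewrite !mulmxA.
Qed.

Let power_ge0 c : {ae mu, forall s, a < s < b -> 0 <= power c s}.
Proof.
apply: ae_imp2 Qpsd Spsd => s h1 h2 sab; apply: addr_ge0.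
  by have := h1 sab (Y s *m c); rewrite quad_form0.
by have := h2 sab (X s *m c); rewrite quad_form0.
Qed.

Let energy0 c : energy c s0 = 0.
Proof. by rewrite /energy D0 quad_form0 mulr0. Qed.

Let Dposdef s : away s -> sym_posdef (D s).
Proof.
move=> As; have /andP[as_ sb] := away_ab As.
split; first by apply: Dsym; rewrite as_.
move=> c c0.
(* The interval between [s] and s0, whichever comes first. *)
pose lo := if fwd then a else s; pose hi := if fwd then s else b.
have lohi : lo < hi.
  move: As; rewrite /away as_ sb /lo /hi /s0 /=.
  case: fwd => ns; first by rewrite lt_neqAle eq_sym ns.
  by rewrite lt_neqAle ns.
have alo : a <= lo by rewrite /lo; case: fwd.
have hib : hi <= b by rewrite /hi; case: fwd.
have mono := prim_nondecreasing (pE c) (power_ge0 c).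
have Dge : 0 <= quad_form (D s) c.
  have := mono _ _ alo (ltW lohi) hib; move: (energy0 c).
  by rewrite /energy /lo /hi /s0 /sg; case: fwd => ->; lra.
rewrite lt_neqAle Dge andbT eq_sym; apply/eqP => Ds0.
have Es : energy c s = 0 by rewrite /energy Ds0 mulr0.
have Elo : energy c lo = 0.
  by move: Es (energy0 c); rewrite /lo /s0; case: fwd.
have Ehi : energy c hi = 0.
  by move: Es (energy0 c); rewrite /hi /s0; case: fwd.
have E0 x : lo <= x <= hi -> energy c x = 0.
  move=> /andP[lx xh]; apply/eqP; rewrite eq_le.
  have := mono lo x alo lx (le_trans xh hib).
  by have := mono x hi (le_trans alo lx) xh hib; rewrite Elo Ehi => -> ->.
(* The energy is zero on all of [lo, hi], so its derivative vanishes where it exists: a nonzero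
   [power] at [x] would force a nonzero energy at x + h. *)
have P0 : {ae mu, forall x, lo < x < hi -> power c x = 0}.
  apply: ae_imp (pE c).2 => x dx xlh.
  have {}dx := dx ltac:(lra).
  apply/eqP/negPn/negP => px.
  have e0 : 0 < `|power c x| / 2 by rewrite divr_gt0// normr_gt0.
  have [r r0 rP] := is_derive_near dx e0.
  pose h := Num.min r (hi - x) / 2.
  have m0 : 0 < Num.min r (hi - x) by rewrite lt_min r0; lra.
  have mr : Num.min r (hi - x) <= r by rewrite ge_min lexx.
  have mb : Num.min r (hi - x) <= hi - x by rewrite ge_min lexx orbT.
  have h0 : 0 < h by rewrite /h; lra.
  have := rP (x + h); rewrite addrAC subrr add0r.
  rewrite (gtr0_norm h0) => /(_ ltac:(by rewrite /h; lra)).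
  rewrite !E0; [|lra|by rewrite /h; lra].
  rewrite subrr sub0r normrN normrM (gtr0_norm h0) ler_pM2r//.
  by have := normr_ge0 (power c x); lra.
(* Both terms of [power] are nonnegative, so each vanishes; for Q this is sharpened to Q Y c = 0,
   which turns the equation of X c into the adjoint one. *)
have both : {ae mu, forall x, lo < x < hi ->
    Q x *m (Y x *m c) = 0 /\ quad_form (S x) (X x *m c) = 0}.
  have H := ae_imp2 (fun x h1 h2 => conj h1 h2) Qpsd Spsd.
  have H' := ae_imp2 (fun x h1 h2 => conj h1 h2) P0 Qsym.
  apply: ae_imp2 H H' => x [h1 h2] [h3 h4] xlh.
  have xab : a < x < b by lra.
  have := h1 xab (Y x *m c); have := h2 xab (X x *m c); rewrite !quad_form0.
  have := h3 xlh; rewrite /power => ps g1 g2.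
  split; last lra.
  by apply: psd_ker; [exact: h4|exact: h1|lra].
have [] := obs (p := fun x => X x *m c) alo lohi hib.
- have := mprimM (mprim_subitv alo hib pX) (mprim_cst lo hi c).
  apply: mprim_ae; apply: ae_imp both => x H /H [QY _].
  by rewrite mulmx0 addr0 mulmxDl -scalemxAl -mulmxA -[Q x *m _ *m _]mulmxA QY
    scaler0 addr0.
- by apply: ae_imp both => x H /H [].
have cE : X s0 *m c = c by rewrite X0 mul1mx.
move: cE; rewrite /lo /hi /s0; case: fwd => cE h1 h2.
  by move: c0; rewrite -cE h1 eqxx.
by move: c0; rewrite -cE h2 eqxx.
Qed.

Let Yunit s : away s -> Y s \in unitmx.
Proof.
move=> As; apply: unitmx_inj => v Yv; apply/eqP/negPn/negP => /(Dposdef As).2.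
by rewrite /quad_form /D -!mulmxA Yv !mulmx0 mxE ltxx.
Qed.

Let P s := X s *m invmx (Y s).

(** P = Y^-T (X^T Y) Y^-1 is congruent to D. *)
Let Pposdef s : away s -> sym_posdef (P s).
Proof.
move=> As; have [Ds Dp] := Dposdef As; have uY := Yunit As.
have PE : P s = (invmx (Y s))^T *m D s *m invmx (Y s).
  by rewrite -Ds /D trmx_mul trmxK mulmxA -trmx_mul mulmxV// trmx1 mul1mx.
split.
  by rewrite PE; move: Ds; move: (D s) => E Es; rewrite !trmx_mul trmxK Es mulmxA.
move=> v v0; rewrite PE.
have : invmx (Y s) *m v != 0.
  apply: contra v0 => /eqP Yv; have := congr1 (mulmx (Y s)) Yv.
  by rewrite mulmxA mulmxV// mul1mx mulmx0 => ->.
by move=> /Dp; rewrite /quad_form trmx_mul !mulmxA.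
Qed.

(** A left eigenvector v of X Y^-1 for l satisfies v X = l v Y. Near s0, X is within 1/2 of the
    identity and Y is at most 1 / (2 (|M| + 1)), so |v| <= l |v| / (2 (|M| + 1)) + |v| / 2, which
    forces l >= |M| + 1. *)
Let P_blowup M : exists2 r, 0 < r &
  forall s, away s -> `|s - s0| < r -> M <= min_spectrum (P s).
Proof.
have M1 : 0 < `|M| + 1 by have := normr_ge0 M; lra.
have e0 : 0 < (2 * (`|M| + 1))^-1 by rewrite invr_gt0; lra.
have h0 : 0 < 1 / 2 :> K by lra.
have [r1 r10 P1] := mprim_unif pX h0.
have [r2 r20 P2] := mprim_unif pY e0.
exists (Num.min r1 r2); first by rewrite lt_min r10.
move=> s As; rewrite lt_min => /andP[sr1 sr2].
have Pp := Pposdef As.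
apply: min_spectrum_ge => //; first exact: Pp.1.
move=> l lP; have l0 := posdef_eigen_gt0 Pp lP.
case/eigenvalueP: lP => v vP v0.
have vX : v *m X s = l *: (v *m Y s).
  rewrite scalemxAl -vP /P -!mulmxA mulVmx ?mulmx1//; exact: Yunit.
have sab := away_ab As.
have k1 := P1 s s0 sab s0ab sr1; have k2 := P2 s s0 sab s0ab sr2.
have nv : 0 < mxn v.
  rewrite lt_neqAle mxn_ge0 andbT eq_sym; apply: contra v0 => /eqP nv.
  by apply/eqP; apply: mxn_sub0; rewrite subr0.
have vE : v = l *: (v *m Y s) + v *m (X s0 - X s).
  by rewrite mulmxBr X0 mulmx1 -vX addrC subrK.
have n1 : mxn v <= mxn (l *: (v *m Y s)) + mxn (v *m (X s0 - X s)).
  by rewrite {1}vE; exact: mxnD.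
have n2 : mxn (v *m (X s0 - X s)) <= mxn v * (1 / 2).
  by apply: le_trans (mxnM _ _) _; apply: ler_wpM2l (ltW k1); exact: ltW.
have n3 : mxn (l *: (v *m Y s)) <= l * (mxn v * (2 * (`|M| + 1))^-1).
  rewrite mxnZ (gtr0_norm l0) ler_pM2l//.
  apply: le_trans (mxnM _ _) _; apply: ler_wpM2l; first exact: ltW.
  by move: k2; rewrite Y0 sub0r mxnN => /ltW.
have n4 : mxn v * (1 / 2) <= mxn v * (l * (2 * (`|M| + 1))^-1).
  by move: n1 n2 n3; rewrite [l * (mxn v * _)]mulrCA; lra.
move: n4; rewrite ler_pM2l// ler_pdivlMr; last lra.
by have := ler_norm M; lra.
Qed.

Lemma quotient_solution : riccati_solution P.
Proof.
split; [exact: Pposdef| |exact: P_blowup].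
move=> c d cd cdA.
have [ac cb] : a <= c /\ d <= b.
  have /away_ab := cdA c ltac:(lra); have /away_ab := cdA d ltac:(lra); lra.
have uY s : c <= s <= d -> Y s \in unitmx by move=> /cdA; exact: Yunit.
have pV := mprim_inv (mprim_subitv ac cb pY) uY.
apply: mprim_eq (mprimM (mprim_subitv ac cb pX) pV) => s scd.
have YV : Y s *m invmx (Y s) = 1%:M by apply: mulmxV; apply: uY; lra.
exact: hamiltonian_quotient.
Qed.

(** * Uniqueness: comparison of an arbitrary solution with X Y^-1 *)

Section uniqueness.
Variable P' : K -> 'M[K]_n.
Hypothesis P'sol : riccati_solution P'.

Let W s := invmx (P' s).

Let P'unit s : away s -> P' s \in unitmx.
Proof. by move=> As; apply: posdef_unit; have [h _ _] := P'sol; exact: h. Qed.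

Let pW c d : c <= d -> (forall s, c <= s <= d -> away s) ->
  mprim c d W (fun s => A s *m W s + W s *m (A s)^T
    - sg *: (W s *m Q s *m W s) + sg *: S s).
Proof.
move=> cd cdA; have [_ h _] := P'sol.
have uP s : c <= s <= d -> P' s \in unitmx by move=> /cdA; exact: P'unit.
apply: mprim_eq (mprim_inv (h c d cd cdA) uP) => s scd.
have uPs : P' s \in unitmx by apply: uP; lra.
have WP : W s *m P' s = 1%:M by exact: mulVmx.
have PW : P' s *m W s = 1%:M by exact: mulmxV.
exact: riccati_inverse.
Qed.

(** Where the spectrum of P' is at least 1/e, P' is coercive with constant 1/e and the entries of
    its inverse are at most e. *)
Let W_small e : 0 < e -> exists2 r, 0 < r &
  forall s i j, away s -> `|s - s0| < r -> `|W s i j| <= e.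
Proof.
move=> e0; have [h _ blow] := P'sol; have [r r0 rP] := blow e^-1.
exists r => // s i j As sr; have m := rP s As sr.
have e1 : 0 < e^-1 by rewrite invr_gt0.
have := @coercive_inv_le _ _ (P' s) e^-1 i j e1; rewrite invrK; apply => v.
apply: le_trans (min_spectrum_psd n0 (h s As) v).
by rewrite !quad_form_scalar ler_wpM2r// sumr_ge0// => k _; exact: sqr_ge0.
Qed.

(** Near s0 by smallness; the rest is a compact interval on which W is continuous. *)
Let W_bounded : exists C, forall s i j, away s -> `|W s i j| <= C.
Proof.
have [r r0 rP] := W_small ltr01.
pose h := Num.min r (b - a) / 2.
have m0 : 0 < Num.min r (b - a) by rewrite lt_min r0 subr_gt0.
have mr : Num.min r (b - a) <= r by rewrite ge_min lexx.
have mb : Num.min r (b - a) <= b - a by rewrite ge_min lexx orbT.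
have h0 : 0 < h by rewrite /h; lra.
have hr : h < r by rewrite /h; lra.
have hb : h < b - a by rewrite /h; lra.
pose c := if fwd then a + h else a; pose d := if fwd then b else b - h.
have cd : c <= d by rewrite /c /d; case: fwd; lra.
have cdA s : c <= s <= d -> away s.
  move=> scd; rewrite /away; apply/andP; split.
    by move: scd; rewrite /c /d; case: fwd; lra.
  by move: scd; rewrite /c /d /s0; case: fwd => ?; apply/eqP; lra.
have [C C0 HC] := mprim_bounded (pW cd cdA).
exists (C + 1) => s i j As.
have [scd|] := boolP (c <= s <= d); first by have := HC s i j scd; lra.
move=> nscd; have := rP s i j As; have : `|s - s0| < r; last first.
  by move=> sr /(_ sr); lra.
have := away_ab As; move: nscd; rewrite /c /d /s0 negb_and -!ltNge ltr_norml.
by case: fwd => /orP[]; lra.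
Qed.

(** W is replaced by zero outside ]a, b[, where nothing is known of it, to obtain a coefficient
    integrable on the whole line. *)
Let flow_coef s := A s - sg *: ((if a < s < b then W s else 0) *m Q s).

Let W_measurable i j :
  measurable_fun setT (fun s => (if a < s < b then W s else 0) i j).
Proof.
rewrite (_ : (fun s => _) = (fun s => W s i j) \_ `]a, b[); last first.
  apply/funext => s; rewrite patchE; case: ifPn => sab.
    by rewrite mem_set//= in_itv.
  by rewrite mxE memNset//= in_itv/=; exact/negP.
apply/(measurable_restrictT _ _).1 => //.
apply: open_continuous_measurable_fun; first exact: itv_open.
move=> s; rewrite inE/= in_itv/= => sab.
pose h := Num.min (s - a) (b - s) / 2.
have m0 : 0 < Num.min (s - a) (b - s) by rewrite lt_min; lra.
have ma : Num.min (s - a) (b - s) <= s - a by rewrite ge_min lexx.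
have mb : Num.min (s - a) (b - s) <= b - s by rewrite ge_min lexx orbT.
have h0 : 0 < h by rewrite /h; lra.
have cd : s - h <= s + h by lra.
have cdA x : s - h <= x <= s + h -> away x.
  by move=> xh; apply: away_in; move: xh; rewrite /h; lra.
apply/cvgrPdist_lt => e e0.
have [r r0 rP] := mprim_unif (pW cd cdA) e0.
near=> x.
have xr : `|s - x| < Num.min r h.
  near: x; apply: (@cvgr_dist_lt _ _ _ _ (nbhs_filter s) id s) => //.
  by rewrite lt_min r0.
move: xr; rewrite lt_min => /andP[xr xh].
have xsh : s - h <= x <= s + h by move: xh; rewrite ltr_norml; lra.
have := rP x s xsh ltac:(lra); rewrite distrC => /(_ xr).
by apply: le_lt_trans; have := le_mxn (W s - W x) i j; rewrite !mxE.
Unshelve. all: by end_near. Qed.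

Let flow_coef_integrable : integrable_mx flow_coef.
Proof.
apply: integrable_mxB => //; apply: integrable_mxZ => i j.
under eq_fun do rewrite mxE.
have [C HC] := W_bounded.
apply: integrable_sumR => k; under eq_fun do rewrite mulrC.
apply: (@integrableM_bounded _ _ _ (`|C|)) => // s.
case: ifPn => sab; last by rewrite mxE normr0.
by apply: le_trans (ler_norm C); apply: HC; exact: away_in.
Qed.

Let flow_coef0 s : s <= a -> flow_coef s = 0.
Proof. by move=> sa; rewrite /flow_coef A0// Q0// mulmx0 scaler0 subr0. Qed.

Let Z s := Y s - W s *m X s.

Let pZ c d : c <= d -> (forall s, c <= s <= d -> away s) ->
  mprim c d Z (fun s => flow_coef s *m Z s).
Proof.
move=> cd cdA.
have [ac db] : a <= c /\ d <= b.
  have /away_ab := cdA c ltac:(lra); have /away_ab := cdA d ltac:(lra); lra.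
apply: mprim_eq (mprimB (mprim_subitv ac db pY)
  (mprimM (pW cd cdA) (mprim_subitv ac db pX))) => s scd.
have sab : a < s < b by lra.
by rewrite /flow_coef sab; exact: riccati_defect.
Qed.

(** With G the inverse flow of [flow_coef], G Z is constant away from s0. Evaluated at points close
    to s0 it is arbitrarily small, because Y and W tend to 0 there while G and X stay bounded. *)
Let Z0 s : away s -> Z s = 0.
Proof.
have [F [G [pF pG GF]]] := adjoint_flow b flow_coef_integrable flow_coef0.
have [CG CG0 HG] := mprim_bounded pG; have [CX CX0 HX] := mprim_bounded pX.
move=> As; suff GZ : G s *m Z s = 0.
  have := congr1 (mulmx (F s)) GZ.
  by rewrite mulmxA (mulmx1C (GF _ (away_ab As))) mul1mx mulmx0.
pose N : K := (n * n)%:R.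
have N0 : 0 <= N by rewrite /N ler0n.
have const t : away t -> G s *m Z s = G t *m Z t.
  move=> At; apply: (@vanish_const _ _ (fun s => G s *m Z s)
      (fun s => - (G s *m flow_coef s) *m Z s + G s *m (flow_coef s *m Z s))) => //.
    move=> c d cd cdA.
    have [ac db] : a <= c /\ d <= b.
      have /away_ab := cdA c ltac:(lra); have /away_ab := cdA d ltac:(lra); lra.
    exact: mprimM (mprim_subitv ac db pG) (pZ cd cdA).
  by apply: aeW => x _; rewrite mulNmx mulmxA addNr.
have small e : 0 < e -> mxn (G s *m Z s) <= N * CG * (e + N * e * (N * CX)).
  move=> e0; have [r1 r10 P1] := W_small e0.
  have [r2 r20 P2] := mprim_unif pY e0.
  have r0 : 0 < Num.min r1 r2 by rewrite lt_min r10.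
  have [t At] := away_near r0; rewrite lt_min => /andP[t1 t2].
  have tab := away_ab At.
  rewrite (const t At); apply: le_trans (mxnM _ _) _.
  apply: ler_pM; rewrite ?mxn_ge0//.
    by apply: mxn_le => i j; exact: HG.
  apply: le_trans (mxnD _ _) _; apply: lerD.
    by have := P2 t s0 tab s0ab t2; rewrite Y0 sub0r mxnN => /ltW.
  rewrite mxnN; apply: le_trans (mxnM _ _) _.
  by apply: ler_pM; rewrite ?mxn_ge0//; apply: mxn_le => i j; [exact: P1|exact: HX].
apply: mxn_sub0; rewrite subr0; apply/eqP; rewrite eq_le mxn_ge0 andbT.
apply/ler_addgt0Pr => e e0; rewrite add0r.
pose B := N * CG * (1 + N * (N * CX)).
have B0 : 0 <= B by rewrite /B !mulr_ge0// addr_ge0// !mulr_ge0.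
have B1 : 0 < B + 1 by lra.
have eB : 0 < e / (B + 1) by exact: divr_gt0.
apply: le_trans (small _ eB) _.
have -> : N * CG * (e / (B + 1) + N * (e / (B + 1)) * (N * CX)) = B * (e / (B + 1)).
  by rewrite /B; ring.
rewrite mulrCA ger_pMr// ler_pdivrMr//; lra.
Qed.

Lemma riccati_solution_uniq s : away s -> P' s = P s.
Proof.
move=> As; have /eqP := Z0 As; rewrite /Z subr_eq0 => /eqP YE.
have PY : P' s *m Y s = X s by rewrite YE mulmxA mulmxV ?mul1mx//; exact: P'unit.
by rewrite /P -PY -mulmxA mulmxV ?mulmx1//; exact: Yunit.
Qed.

End uniqueness.

End solution.

Lemma riccati_exists_unique :
  {ae mu, forall s, a < s < b -> (S s)^T = S s} ->
  exists P, riccati_solution P /\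
    forall P', riccati_solution P' -> forall s, away s -> P' s = P s.
Proof.
move=> Ssym.
have [X [Y [X0 Y0 pX pY]]] := hamiltonian_flow sg Ai Qi Si A0 Q0 S0 s0ab.
exists (fun s => X s *m invmx (Y s)); split; first exact: (quotient_solution X0 Y0 pX pY Ssym).
by move=> P' hP' s As; exact: (riccati_solution_uniq X0 Y0 pX pY Ssym hP' As).
Qed.

End riccati.

(** * Caratheodory solutions *)

Section caratheodory.
Variables (K : realType) (k l : nat).
Notation mu := (@lebesgue_measure K).
Implicit Types X G : K -> 'M[K]_(k, l).

Lemma mx_norm_le (M : 'M[K]_(k, l)) : `|M| <= mxn M.
Proof.
rewrite /Num.Def.normr/= mx_normrE; apply: bigmax_le => [|[i j] _]; first exact: mxn_ge0.
exact: le_mxn.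
Qed.

Lemma le_mx_norm (M : 'M[K]_(k, l)) i j : `|M i j| <= `|M|.
Proof.
rewrite [leRHS]/Num.Def.normr/= mx_normrE.
by rewrite (le_trans _ (le_bigmax _ _ (i, j)))//.
Qed.

Lemma derivable_mxE X G (s : K) :
  (forall i j, is_derive s (1 : K) (fun s => X s i j) (G s i j)) ->
  derivable X s 1 /\ derive1 X s = G s.
Proof.
move=> h; have dX : derivable X s 1.
  by apply/derivable_mxP => i j; have [] := h i j.
split => //; rewrite derive1E derive_mx//; apply/matrixP => i j; rewrite mxE.
by have [] := h i j.
Qed.

(** Passes from an implicit equation that determines the derivative almost everywhere to an explicit
    entrywise derivative. *)
Lemma caratheodory_mprim (J : set K) E X G c d :
  caratheodory_solution J E X -> c <= d -> (forall s, c <= s <= d -> J s) ->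
  {ae mu, forall s, c < s < d -> forall dX, E s (X s) dX -> dX = G s} ->
  mprim c d X G.
Proof.
move=> [acX dX] cd cdJ EG i j; split.
  have cdJ' : `[c, d] `<=` J by move=> s /=; rewrite in_itv/=; exact: cdJ.
  apply: (@small_incr_le _ _ _ _ (fun u v => `|X v - X u|) _ (acX c d cd cdJ')).
  by move=> u v _ _ _; have := le_mx_norm (X v - X u) i j; rewrite !mxE.
apply: ae_imp2 EG dX => s EG dX scd.
have [dXs /EG XG] := dX (cdJ s ltac:(lra)).
have {}XG := XG scd.
have dXij : derivable (fun s => X s i j) s 1 by exact: (iffLR (derivable_mxP _ _ _) dXs).
by split => //; rewrite -XG derive1E derive_mx// mxE.
Qed.

Lemma ae_neq (c : K) : {ae mu, forall s, s != c}.
Proof.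
exists [set c]; split => //; first exact: lebesgue_measure_set1.
by move=> s /= /negP; rewrite negbK => /eqP.
Qed.

(** The intervals ]a + w m, b - w m[ exhaust ]a, b[, and countably many null sets form a null set.
    The denominator m + 2 keeps a + w m <= b - w m. *)
Lemma ae_exhaust (a b : K) (E : K -> Prop) : a < b ->
  (forall c d, a < c -> c <= d -> d < b -> {ae mu, forall s, c < s < d -> E s}) ->
  {ae mu, forall s, a < s < b -> E s}.
Proof.
move=> ab h.
pose w (m : nat) := (b - a) / m.+2%:R.
have w0 m : 0 < w m by apply: divr_gt0; rewrite ?subr_gt0.
have wb m : w m <= (b - a) / 2.
  rewrite /w ler_pM2l ?subr_gt0// lef_pV2 ?posrE// ler_nat//.
have H : {ae mu, forall s, forall m, a + w m < s < b - w m -> E s}.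
  apply/ae_foralln => m; apply: h.
  - by have := w0 m; lra.
  - by have := wb m; lra.
  - by have := w0 m; lra.
apply: ae_imp H => s H sab.
pose e := Num.min (s - a) (b - s) / (b - a).
have m0 : 0 < Num.min (s - a) (b - s) by rewrite lt_min; lra.
have ma : Num.min (s - a) (b - s) <= s - a by rewrite ge_min lexx.
have mb : Num.min (s - a) (b - s) <= b - s by rewrite ge_min lexx orbT.
have e0 : 0 < e by apply: divr_gt0 => //; rewrite subr_gt0.
have [m em] := ltr_add_invr e0; rewrite add0r in em.
apply: (H m); have : w m < Num.min (s - a) (b - s); last by lra.
have -> : Num.min (s - a) (b - s) = (b - a) * e.
  by rewrite /e mulrCA mulfV ?mulr1// gt_eqF// subr_gt0.
rewrite /w ltr_pM2l ?subr_gt0//; apply: le_lt_trans em.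
by rewrite lef_pV2 ?posrE// ler_nat.
Qed.

Lemma mprim_caratheodory (J : set K) (a b : K) E X G : a < b ->
  (forall s, a < s < b -> J s) -> (forall s, J s -> a <= s <= b) ->
  (forall c d, c <= d -> (forall s, c <= s <= d -> J s) -> mprim c d X G) ->
  {ae mu, forall s, a < s < b -> E s (X s) (G s)} ->
  caratheodory_solution J E X.
Proof.
move=> ab abJ Jab pX EG; split.
  move=> c d cd cdJ.
  have h : mprim c d X G.
    by apply: pX => // s scd; apply: cdJ; rewrite /= in_itv.
  suff : small_increments c d (fun u v => `|X v - X u|) by [].
  by apply: small_incr_le (mprim_incr h) => u v _ _ _; exact: mx_norm_le.
have dX : {ae mu, forall s, a < s < b -> forall ij : 'I_k * 'I_l,
    is_derive s 1 (fun s => X s ij.1 ij.2) (G s ij.1 ij.2)}.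
  apply: ae_exhaust => // c d ac cd db.
  have h : mprim c d X G by apply: pX => // s scd; apply: abJ; lra.
  have : {ae mu, forall s, forall ij : 'I_k * 'I_l, c < s < d ->
      is_derive s 1 (fun s => X s ij.1 ij.2) (G s ij.1 ij.2)}.
    by apply: ae_forall => -[i j]; exact: (h i j).2.
  by apply: ae_imp => s H scd ij; exact: H.
(* J may contain an end point of [a, b], where neither the derivative nor the equation is known; the
   two end points form a null set. *)
have H1 := ae_imp2 (fun x h1 h2 => conj h1 h2) (ae_neq a) (ae_neq b).
have H2 := ae_imp2 (fun x h1 h2 => conj h1 h2) dX EG.
apply: ae_imp2 H1 H2 => s [sa sb] [h1 h2] /Jab/andP[as_ sb'].
have sab : a < s < b by rewrite !lt_neqAle as_ sb' sb eq_sym sa.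
have [d1 d2] : derivable X s 1 /\ derive1 X s = G s.
  by apply: derivable_mxE => i j; exact: (h1 sab (i, j)).
by rewrite d2; split => //; exact: h2.
Qed.

End caratheodory.

(** * Coefficients of the control system *)

Section measurable_matrices.
Variables (K : realType).
Notation mu := (@lebesgue_measure K).
Implicit Types f : K -> K.

Definition measurable_mx k l (M : K -> 'M[K]_(k, l)) :=
  forall i j, measurable_fun setT (fun s => M s i j).

(* x^-1 = x (x^2)^-1 reduces to the library's measurability of powers. *)
Lemma measurable_funV f : measurable_fun setT f -> measurable_fun setT (fun s => (f s)^-1).
Proof.
move=> mf; rewrite (_ : (fun s => _) = fun s => f s * (f s ^+ 2) `^ (-1)); last first.
  apply/funext => s; rewrite powR_inv1 ?sqr_ge0//.
  have [->|fs] := eqVneq (f s) 0; first by rewrite invr0 mul0r.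
  by rewrite expr2 invfM mulrA mulfV// mul1r.
apply: measurable_funM => //.
apply: (measurableT_comp (@measurable_powR K (-1))).
exact: measurable_funX.
Qed.

Lemma measurable_det n (M : K -> 'M[K]_n) : measurable_mx M ->
  measurable_fun setT (fun s => \det (M s)).
Proof.
move=> mM; apply: measurable_sum => sg; apply: measurable_funM.
  exact: measurable_cst.
by apply: measurable_prod => i _; exact: mM.
Qed.

(** Cramer's rule: each entry is a cofactor divided by the determinant. *)
Lemma measurable_invmx n (M : K -> 'M[K]_n) : measurable_mx M ->
  (forall s, M s \in unitmx) -> measurable_mx (fun s => invmx (M s)).
Proof.
move=> mM uM i j.
rewrite (_ : (fun s => _) = fun s => (\det (M s))^-1 * cofactor (M s) j i); last first.
  by apply/funext => s; rewrite /invmx uM mxE mxE.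
apply: measurable_funM; first by apply: measurable_funV; exact: measurable_det.
apply: measurable_funM; first exact: measurable_cst.
apply: measurable_det => k l.
by under eq_fun do rewrite !mxE; exact: mM.
Qed.

Lemma measurable_mx_if k l (G : set K) (M N : K -> 'M[K]_(k, l)) :
  measurable G -> (forall i j, measurable_fun G (fun s => M s i j)) ->
  measurable_mx N -> measurable_mx (fun s => if s \in G then M s else N s).
Proof.
move=> mG mM mN i j.
rewrite (_ : (fun s => _) = fun s => if s \in G then M s i j else N s i j); last first.
  by apply/funext => s; case: ifP.
have GE : (fun s => s \in G) @^-1` [set true] = G.
  by apply/seteqP; split => x /=; [move/set_mem|move/mem_set].
apply: measurable_fun_if => //.
- by apply: (measurable_fun_bool true); rewrite GE setTI.
- by rewrite setTI GE.
- exact: measurable_funTS.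
Qed.

Lemma integrable_restrict_itv (D G : set K) (f : K -> K) : measurable D -> measurable G ->
  G `<=` D -> mu.-integrable setT (EFin \o (f \_ D)) ->
  mu.-integrable setT (EFin \o (f \_ G)).
Proof.
move=> mD mG GD; rewrite -!restrict_EFin => fD.
have {fD} h := (@integrable_mkcond _ _ _ mu D (EFin \o f) mD).2 fD.
by apply: (@integrable_mkcond _ _ _ mu G (EFin \o f) mG).1; exact: integrableS h.
Qed.

End measurable_matrices.

(** * Translation between the stated problems and their common form *)

Section transfer.
Variables (K : realType) (n : nat) (a b : K) (fwd : bool).
Notation mu := (@lebesgue_measure K).
Let s0 := if fwd then a else b.

Lemma away_continuous (J : set K) (P G : K -> 'M[K]_n) :
  (forall s, J s <-> away a b fwd s) ->
  (forall c d, c <= d -> (forall s, c <= s <= d -> away a b fwd s) -> mprim c d P G) ->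
  {within J, continuous P}.
Proof.
move=> JA pP; apply/subspace_continuousP => x /JA Ax.
have /andP[/andP[ax xb] xs] := Ax.
have d0 : 0 < `|x - s0| / 2 by rewrite divr_gt0// normr_gt0 subr_eq0.
(* Half the distance to s0 keeps [c, d] away from it, while [c, d] is still a neighbourhood of [x]
   within J. *)
pose h := `|x - s0| / 2; pose c := Num.max a (x - h); pose d := Num.min b (x + h).
have h0 : 0 < h by [].
have cx : c <= x by rewrite ge_max ax/=; lra.
have xd : x <= d by rewrite le_min xb/=; lra.
have cdA s : c <= s <= d -> away a b fwd s.
  rewrite ge_max le_min => /andP[/andP[as_ s1] /andP[sb s2]].
  rewrite /away as_ sb/=; apply/eqP => e.
  have : `|x - s| <= h by rewrite ler_norml; lra.
  rewrite e -/s0 /h; move: d0; lra.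
have pcd := pP c d (le_trans cx xd) cdA.
apply/cvgrPdist_lt => e e0; have [r r0 rP] := mprim_unif pcd e0.
near=> y.
have Jy : J y by near: y; exact: withinT.
have yr : `|x - y| < Num.min r h.
  near: y; apply: cvg_within.
  apply: (@cvgr_dist_lt _ _ _ _ (nbhs_filter x) id x) => //.
  by rewrite lt_min r0.
move: yr; rewrite lt_min => /andP[yr yh].
have /JA/andP[/andP[ay yb] _] := Jy.
have ycd : c <= y <= d.
  by move: yh; rewrite ge_max le_min ay yb ltr_norml; lra.
have xcd : c <= x <= d by rewrite cx xd.
apply: le_lt_trans (rP y x ycd xcd _); first exact: mx_norm_le.
by rewrite distrC.
Unshelve. all: by end_near. Qed.

(** An equivalence, because one direction carries existence and the other uniqueness over to the
    stated problem. *)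
Lemma transfer_solution (J : set K) E (F : set_system K) (A Q S P : K -> 'M[K]_n) :
  a < b -> (forall s, J s <-> away a b fwd s) ->
  {ae mu, forall s, a < s < b -> forall M dM,
     E s M dM <-> dM = riccati_rhs fwd A Q S s M} ->
  (forall f : K -> K, f @ F --> +oo <-> forall M, exists2 r, 0 < r &
     forall s, away a b fwd s -> `|s - s0| < r -> M <= f s) ->
  [/\ continuous_posdef J P, caratheodory_solution J E P &
    min_spectrum (P s) @[s --> F] --> +oo] <->
  riccati_solution a b fwd A Q S P.
Proof.
move=> ab JA hE hF; split.
  move=> [[_ Jpos] cara /hF blow]; split => //.
    by move=> s /JA/Jpos.
  move=> c d cd cdA; apply: (caratheodory_mprim cara) => //.
    by move=> s /cdA/JA.
  apply: ae_imp hE => s hE scd dX; apply: (hE _ _ _).1.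
  have /andP[+ _] := cdA c ltac:(lra); have /andP[+ _] := cdA d ltac:(lra); lra.
move=> [Apos pP blow]; split; last by apply/hF.
  split; first exact: (away_continuous JA pP).
  by move=> s /JA/Apos.
apply: (mprim_caratheodory ab) => [s sab|s|c d cd cdJ|].
- apply/JA; rewrite /away; apply/andP; split; first lra.
  by case: fwd; apply/eqP; lra.
- by move=> /JA/andP[].
- by apply: pP => // s /cdJ/JA.
by apply: ae_imp hE => s hE sab; apply: (hE sab _ _).2.
Qed.

End transfer.

Lemma blowup_left (K : realType) (a b : K) (f : K -> K) : a < b ->
  f @ b^'- --> +oo <-> forall M, exists2 r, 0 < r &
     forall s, away a b false s -> `|s - b| < r -> M <= f s.
Proof.
move=> ab; split.
  move=> /cvgryPge h M; have /nbhs_ballP[r /= r0 rP] := h M.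
  exists r => // s /andP[/andP[as_ sb] /= nsb] sr.
  by apply: rP; rewrite /ball/= 1?distrC// lt_neqAle nsb.
move=> h; apply/cvgryPge => M; have [r r0 rP] := h M.
(* The bound b - a keeps the points to the left of [b] inside [a, b[. *)
apply/nbhs_ballP; exists (Num.min r (b - a)) => /=.
  by rewrite lt_min r0 subr_gt0.
move=> s; rewrite /ball/= distrC lt_min => /andP[sr sa] sb.
apply: rP => //; rewrite /away/= (ltW sb) lt_eqF//= !andbT.
by move: sa; rewrite ltr_norml; lra.
Qed.

Lemma blowup_right (K : realType) (a b : K) (f : K -> K) : a < b ->
  f @ a^'+ --> +oo <-> forall M, exists2 r, 0 < r &
     forall s, away a b true s -> `|s - a| < r -> M <= f s.
Proof.
move=> ab; split.
  move=> /cvgryPge h M; have /nbhs_ballP[r /= r0 rP] := h M.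
  exists r => // s /andP[/andP[as_ sb] /= nsa] sr.
  by apply: rP; rewrite /ball/= 1?distrC// lt_neqAle eq_sym nsa.
move=> h; apply/cvgryPge => M; have [r r0 rP] := h M.
apply/nbhs_ballP; exists (Num.min r (b - a)) => /=.
  by rewrite lt_min r0 subr_gt0.
move=> s; rewrite /ball/= distrC lt_min => /andP[sr sa] sb.
apply: rP => //; rewrite /away/= (ltW sb) gt_eqF//= !andbT.
by move: sa; rewrite ltr_norml; lra.
Qed.

(** * The control system satisfies the assumptions of the common form *)

Section control_data.
Variables (K : realType) (n m : nat) (T : K).
Variables (A : K -> 'M[K]_n) (B : K -> 'M[K]_(n, m)).
Variables (Q : K -> 'M[K]_n) (R : K -> 'M[K]_m).
Notation mu := (@lebesgue_measure K).
Hypotheses (A_L1 : Lp_mx 1%:E `]0, T[%classic A)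
  (B_L2 : Lp_mx 2%:E `]0, T[%classic B)
  (AB_controllable : completely_controllable T A B)
  (Q_L1 : Lp_mx 1%:E `]0, T[%classic Q)
  (Q_sym : ae_on `]0, T[%classic (fun s => (Q s)^T = Q s))
  (Q_ge0 : ae_on `]0, T[%classic (fun s => psd_le 0 (Q s)))
  (R_Loo : Lp_mx +oo%E `]0, T[%classic R)
  (R_sym : ae_on `]0, T[%classic (fun s => (R s)^T = R s)).
Variable delta : K.
Hypotheses (delta_gt0 : 0 < delta)
  (R_ge : ae_on `]0, T[%classic (fun s => psd_le delta%:M (R s))).
Variables a b : K.
Hypotheses (a0 : 0 <= a) (ab : a < b) (bT : b <= T).

Let I : set K := `]a, b[%classic.

Let mI : measurable I. Proof. exact: measurable_itv. Qed.

Let inI s : (s \in I) = (a < s < b).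
Proof. by apply/idP/idP; [move/set_mem|move=> h; apply/mem_set]; rewrite /I/= in_itv. Qed.

Let ID : I `<=` `]0, T[%classic.
Proof.
move=> s; rewrite /I/= !in_itv/= => /andP[as_ sb].
by rewrite (le_lt_trans a0 as_) (lt_le_trans sb bT).
Qed.

(** Extension by zero makes the coefficients integrable on the line and zero to the left of [a], as
    Picard iteration from [a] requires. *)
Definition cutoff k l (M : K -> 'M[K]_(k, l)) (s : K) : 'M[K]_(k, l) :=
  if s \in I then M s else 0.

Let cutoffE k l (M : K -> 'M[K]_(k, l)) i j :
  (fun s => cutoff M s i j) = (fun s => M s i j) \_ I.
Proof. by apply/funext => s; rewrite patchE /cutoff; case: ifP => // _; rewrite mxE. Qed.

Let cutoff0 k l (M : K -> 'M[K]_(k, l)) s : s <= a -> cutoff M s = 0.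
Proof. by move=> sa; rewrite /cutoff inI ltNge sa. Qed.

Let cutoff_in k l (M : K -> 'M[K]_(k, l)) s : a < s < b -> cutoff M s = M s.
Proof. by move=> sab; rewrite /cutoff inI sab. Qed.

Let cutoff_integrable k l (M : K -> 'M[K]_(k, l)) :
  Lp_mx 1%:E `]0, T[%classic M -> integrable_mx (cutoff M).
Proof.
move=> ML i j; rewrite cutoffE; apply: (integrable_restrict_itv _ _ ID) => //.
exact: (Lfun1_integrable _ _).1 (ML i j).
Qed.

Let Rgood : {ae mu, forall s, 0 < s < T -> (R s)^T = R s /\ psd_le delta%:M (R s)}.
Proof.
apply: ae_imp2 R_sym R_ge => s h1 h2 s0T.
by split; [apply: h1|apply: h2]; rewrite /= in_itv.
Qed.

(* Redefining R on a null set makes the properties of R^-1 hold everywhere. *)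
Lemma regular_weight : exists W : K -> 'M[K]_m,
  [/\ measurable_mx W, forall s, (W s)^T = W s, forall s, psd_le delta%:M (W s) &
  {ae mu, forall s, a < s < b -> W s = R s}].
Proof.
have [N [mN N0 RN]] := Rgood.
pose G := I `\` N; have mG : measurable G by exact: measurableD.
have GR s : G s -> (R s)^T = R s /\ psd_le delta%:M (R s).
  move=> [Is nNs]; apply: contrapT => H; apply: nNs; apply: RN => /= h.
  by apply: H; apply: h; have := ID Is; rewrite /= in_itv.
exists (fun s => if s \in G then R s else delta%:M); split.
- apply: (measurable_mx_if mG) => i j; last first.
    exact: measurable_cst.
  have mD : measurable (`]0, T[%classic : set K) by exact: measurable_itv.
  have : measurable_fun setT ((fun s => R s i j) \_ `]0, T[).
    by have /andP[/[!inE]/= mf _] := R_Loo i j.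
  move=> /(measurable_restrictT _ mD).2 h.
  by apply: measurable_funS h => // s [/ID].
- by move=> s; case: ifPn => [/set_mem/GR[]//|_]; rewrite tr_scalar_mx.
- by move=> s; case: ifPn => [/set_mem/GR[]//|_] v.
exists N; split => // s /= H; apply: contrapT => nNs; apply: H => sab.
by rewrite mem_set//; split => //; rewrite /I/= in_itv.
Qed.

Variable W : K -> 'M[K]_m.
Hypotheses (mW : measurable_mx W) (Wsym : forall s, (W s)^T = W s)
  (Wge : forall s, psd_le delta%:M (W s))
  (WR : {ae mu, forall s, a < s < b -> W s = R s}).

(** The matrix S = B R^-1 B^T, with [W] the everywhere symmetric and coercive version of R. *)
Definition gramian s := cutoff B s *m invmx (W s) *m (cutoff B s)^T.

Let Wunit s : W s \in unitmx. Proof. exact: coercive_unit (Wge s). Qed.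

(** Products of two square integrable entries of B are integrable, and the entries of W^-1 are
    measurable and bounded by 1 / delta. *)
Let gramian_integrable : integrable_mx gramian.
Proof.
move=> i j.
rewrite (_ : (fun s => _) = fun s => \sum_k \sum_l
  (cutoff B s i l * cutoff B s j k) * invmx (W s) l k); last first.
  apply/funext => s; rewrite /gramian mxE; apply: eq_bigr => k _.
  rewrite mxE mulr_suml; apply: eq_bigr => l _.
  by rewrite [(cutoff B s)^T _ _]mxE mulrAC.
apply: integrable_sumR => k; apply: integrable_sumR => l.
apply: (@integrableM_bounded _ _ _ delta^-1).
- rewrite (_ : (fun s => _) = (fun s => B s i l * B s j k) \_ I); last first.
    apply/funext => s; rewrite patchE /cutoff; case: ifP => // _.
    by rewrite mxE mul0r.
  apply: (integrable_restrict_itv _ _ ID) => //.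
  rewrite (_ : _ \_ _ = ((fun s => B s i l) \_ `]0, T[) \* ((fun s => B s j k) \_ `]0, T[)).
    exact: (Lfun1_integrable _ _).1 (Lfun2_mul_Lfun1 (B_L2 i l) (B_L2 j k)).
  apply/funext => s /=; rewrite !patchE.
  by case: ifP => // _; rewrite mulr0.
- exact: measurable_invmx.
- by move=> s; exact: coercive_inv_le.
Qed.

(** With w = W^-1 B^T v one has v^T S v = w^T W w, so positivity of S and its kernel follow from the
    coercivity of W. *)
Let gramianE s v : quad_form (gramian s) v =
  quad_form (W s) (invmx (W s) *m ((cutoff B s)^T *m v)).
Proof.
rewrite /quad_form /gramian !trmx_mul trmxK trmx_inv Wsym.
rewrite -!mulmxA [W s *m _]mulmxA mulmxV// mul1mx.
by rewrite !mulmxA.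
Qed.

Let sum_sqr_ge0 k (w : 'cV[K]_k) : 0 <= \sum_i w i ord0 ^+ 2.
Proof. by apply: sumr_ge0 => i _; exact: sqr_ge0. Qed.

Let gramian_psd s : psd_le 0 (gramian s).
Proof.
move=> v; rewrite quad_form0 gramianE; apply: le_trans (Wge s _).
by rewrite quad_form_scalar mulr_ge0// ltW.
Qed.

Let gramian_sym s : (gramian s)^T = gramian s.
Proof. by rewrite /gramian !trmx_mul trmxK trmx_inv Wsym mulmxA. Qed.

Let gramian_ker s v : quad_form (gramian s) v = 0 -> (cutoff B s)^T *m v = 0.
Proof.
rewrite gramianE; set w := _ *m (_ *m v) => w0.
have {w0} : w = 0.
  apply/eqP/negPn/negP => /sum_sqr_gt0 wpos; have := Wge s w.
  by rewrite w0 quad_form_scalar; have := mulr_gt0 delta_gt0 wpos; lra.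
by move=> /(congr1 (mulmx (W s))); rewrite /w mulmxA mulmxV// mul1mx mulmx0.
Qed.

(* If p solves the adjoint equation and B^T p = 0, then p^T X is constant along
   every controlled trajectory X. *)
Let observable c d (p : K -> 'cV[K]_n) : a <= c -> c < d -> d <= b ->
  mprim c d p (fun s => - (cutoff A s)^T *m p s) ->
  {ae mu, forall s, c < s < d -> quad_form (gramian s) (p s) = 0} ->
  p c = 0 /\ p d = 0.
Proof.
move=> ac cd db pp p0.
(* The system can be steered from any [x] to any [y], so constancy of p^T X holds with both ends
   arbitrary. *)
have key (x y : 'cV[K]_n) : (p c)^T *m x = (p d)^T *m y.
  have [u [_ [X [Xsol Xc Xd]]]] :=
    AB_controllable (le_trans a0 ac) cd (le_trans db bT) x y.
  have pX : mprim c d X (fun s => A s *m X s + B s *m u s).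
    apply: (caratheodory_mprim Xsol (ltW cd)) => [s|]; first by rewrite /= in_itv.
    by apply: aeW.
  rewrite -Xc -Xd; apply: (mprim_const (mprimM (mprim_tr pp) pX)) => //; last exact: ltW.
  apply: ae_imp p0 => s H scd; have := gramian_ker (H scd).
  have sab : a < s < b by lra.
  rewrite !cutoff_in// => Bp; rewrite trmx_mul [(- _)^T]raddfN/= trmxK.
  rewrite mulmxDr mulmxN mulNmx !mulmxA addrA addNr add0r.
  by rewrite -[B s]trmxK -trmx_mul Bp trmx0 mul0mx.
have zero (q : 'cV[K]_n) : q^T *m q = 0 -> q = 0.
  move=> qq; apply/eqP/negPn/negP => /sum_sqr_gt0.
  have := congr1 (fun M : 'M[K]_1 => M ord0 ord0) qq; rewrite !mxE => E.
  rewrite -[X in 0 < X]mul1r -quad_form_scalar /quad_form mulmx1 mxE E ltxx.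
  by [].
(* Taken at x = p c, y = 0, then at x = 0, y = p d. *)
split; apply: zero; first by rewrite (key _ 0) mulmx0.
by rewrite -(key 0) mulmx0.
Qed.

Lemma regularized_exists_unique fwd : (0 < n)%N -> exists P,
  riccati_solution a b fwd (cutoff A) (cutoff Q) gramian P /\
  forall P', riccati_solution a b fwd (cutoff A) (cutoff Q) gramian P' ->
  forall s, away a b fwd s -> P' s = P s.
Proof.
move=> n0; apply: riccati_exists_unique => //.
- exact: cutoff_integrable.
- exact: cutoff_integrable.
- by move=> s; exact: cutoff0.
- by move=> s; exact: cutoff0.
- by move=> s sa; rewrite /gramian cutoff0// mul0mx mul0mx.
- apply: ae_imp Q_sym => s h sab; rewrite cutoff_in//; apply: h.
  by apply: ID; rewrite /I/= in_itv.
- apply: ae_imp Q_ge0 => s h sab; rewrite cutoff_in//; apply: h.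
  by apply: ID; rewrite /I/= in_itv.
- exact: aeW.
- exact: aeW.
Qed.

Lemma regularized_rhs : {ae mu, forall s, a < s < b -> forall fwd M,
  riccati_rhs fwd (cutoff A) (cutoff Q) gramian s M =
  riccati_rhs fwd A Q (fun s => B s *m invmx (R s) *m (B s)^T) s M}.
Proof.
apply: ae_imp WR => s h sab fwd M.
by rewrite /riccati_rhs /gramian !cutoff_in// h.
Qed.

End control_data.

Unset Implicit Arguments.
Set Strict Implicit.
Set Printing Implicit Defensive.

Theorem theorem3p1 (K : realType) (n m : nat) (n_gt0 : (0 < n)%N)
    (T : K) (T_gt0 : 0 < T)
    (A : K -> 'M[K]_n) (B : K -> 'M[K]_(n, m))
    (Q : K -> 'M[K]_n) (R : K -> 'M[K]_m)
    (A_L1 : Lp_mx 1%:E `]0, T[%classic A)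
    (B_L2 : Lp_mx 2%:E `]0, T[%classic B)
    (AB_controllable : completely_controllable T A B)
    (Q_L1 : Lp_mx 1%:E `]0, T[%classic Q)
    (Q_sym : ae_on `]0, T[%classic (fun s => (Q s)^T = Q s))
    (Q_ge0 : ae_on `]0, T[%classic (fun s => psd_le 0 (Q s)))
    (R_Loo : Lp_mx +oo%E `]0, T[%classic R)
    (R_sym : ae_on `]0, T[%classic (fun s => (R s)^T = R s))
    (delta : K) (delta_gt0 : 0 < delta)
    (R_ge : ae_on `]0, T[%classic (fun s => psd_le delta%:M (R s)))
    (t : K) (t_ge0 : 0 <= t) (t_ltT : t < T) :
  exists_unique_on `[0, T[%classic (riccati_P T A B Q R) /\
  exists_unique_on `]t, T]%classic (riccati_Pi t T A B Q R).
Proof.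
split.
- have [W [mW Wsym Wge WR]] :=
    regular_weight R_Loo R_sym R_ge (lexx 0) (lexx T).
  have rhsE := regularized_rhs A B Q WR.
  have JA s : `[0, T[%classic s <-> away 0 T false s.
    rewrite /= in_itv/= /away/=; split=> [/andP[s0 sT]|/andP[/andP[s0 sT] nsT]].
      by rewrite s0 (ltW sT) lt_eqF.
    by rewrite s0 lt_neqAle nsT.
  have tr P : riccati_P T A B Q R P <->
      riccati_solution 0 T false (cutoff 0 T A) (cutoff 0 T Q) (gramian B 0 T W) P.
    apply: transfer_solution => //; last by move=> f; exact: blowup_left.
    apply: ae_imp rhsE => s h sab M dM; rewrite h// /riccati_rhs/= !scaleN1r opprK.
    rewrite !mulmxA; split=> [H|->].
      by apply/subr0_eq; rewrite -H; apply/matrixP => i j; rewrite !mxE; ring.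
    by apply/matrixP => i j; rewrite !mxE; ring.
  have [P [solP uniqP]] := regularized_exists_unique A_L1 B_L2 AB_controllable
    Q_L1 Q_sym Q_ge0 delta_gt0 (lexx 0) T_gt0 (lexx T) mW Wsym Wge false n_gt0.
  exists P; split; first exact/tr.
  by move=> P' /tr/uniqP H s /JA/H.
- have [W [mW Wsym Wge WR]] :=
    regular_weight R_Loo R_sym R_ge t_ge0 (lexx T).
  have rhsE := regularized_rhs A B Q WR.
  have JA s : `]t, T]%classic s <-> away t T true s.
    rewrite /= in_itv/= /away/=; split=> [/andP[ts sT]|/andP[/andP[ts sT] nst]].
      by rewrite (ltW ts) sT gt_eqF.
    by rewrite sT lt_neqAle eq_sym nst ts.
  have tr P : riccati_Pi t T A B Q R P <->
      riccati_solution t T true (cutoff t T A) (cutoff t T Q) (gramian B t T W) P.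
    apply: transfer_solution => //; last by move=> f; exact: blowup_right.
    apply: ae_imp rhsE => s h sab M dM; rewrite h// /riccati_rhs/= !scale1r.
    rewrite !mulmxA; split=> [H|->].
      by apply/subr0_eq; rewrite -H; apply/matrixP => i j; rewrite !mxE; ring.
    by apply/matrixP => i j; rewrite !mxE; ring.
  have [P [solP uniqP]] := regularized_exists_unique A_L1 B_L2 AB_controllable
    Q_L1 Q_sym Q_ge0 delta_gt0 t_ge0 t_ltT (lexx T) mW Wsym Wge true n_gt0.
  exists P; split; first exact/tr.
  by move=> P' /tr/uniqP H s /JA/H.
Qed.
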